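(* For every positive integer $k$ there exists a constant $c = c(k) > 0$ such that every tournament $T$ on $n$ vertices with $\delta^{0}(T) \geq \frac{n}{4} + c\, n^{1- 1/ \lceil k/2 \rceil}$ contains the $k$-th power of a Hamilton cycle.
   Context: A tournament is an orientation of a complete graph. $\delta^0(T)$, the minimum semidegree, is the minimum over all vertices of $T$ of their in-degrees and out-degrees. For a directed path $v_0v_1\ldots v_l$, its $k$-th power is the directed graph on $\{v_0,\ldots,v_l\}$ with an edge $v_iv_j$ if and only if $i<j\le i+k$; the $k$-th power of a directed cycle $v_0v_1\ldots v_{l}v_0$ is defined analogously with indices taken cyclically (edges $v_iv_{i+1},\ldots,v_iv_{i+k}$, indices mod $l+1$). A tournament contains the $k$-th power of a Hamilton cycle if it contains, as a subgraph, the $k$-th power of a directed cycle through all of its vertices. *)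

(* Defs.v *)
From mathcomp Require Import all_boot.
Set Implicit Arguments.
Unset Strict Implicit.
Unset Printing Implicit Defensive.

(* Digraphs are boolean relations: e x y means that there is an edge from x to y. *)

Definition tournament (V : finType) (e : rel V) : Prop :=
  irreflexive e /\ forall x y : V, x != y -> e x y (+) e y x.

Definition outdeg (V : finType) (e : rel V) (x : V) : nat := #|[set y | e x y]|.
Definition indeg (V : finType) (e : rel V) (x : V) : nat := #|[set y | e y x]|.

(* No degree exceeds #|V|, so the neutral value #|V| of the iterated minimum
   does not affect it when V is nonempty. *)
Definition min_semidegree (V : finType) (e : rel V) : nat :=
  \big[minn/#|V|]_(x : V) minn (indeg e x) (outdeg e x).

(* Intended for m > k; if m <= k, then d.+1 = m produces loops, and an
   irreflexive digraph contains no nonempty such cycle power. *)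
Definition cycle_power (k m : nat) : rel 'I_m :=
  fun i j => [exists d : 'I_k, (j : nat) == (i + d.+1) %% m].

(* H is isomorphic to a (not necessarily induced) subgraph of G. *)
Definition contains_copy (W V : finType) (H : rel W) (G : rel V) : Prop :=
  exists2 f : W -> V, injective f & forall x y : W, H x y -> G (f x) (f y).

Definition contains_hamilton_cycle_power
    (k : nat) (V : finType) (e : rel V) : Prop :=
  contains_copy (@cycle_power k #|V|) e.

(* Main.v *)
(** Let [r = uphalf k], so that [2 r >= k] (the lemmas below have [r.+1] in place of [r]), and let
    [s] be the excess of the semidegrees over [n/4].

    Sparse edges.  If [e(X, Y)] is at least a large multiple of [n^(2-1/r)], a Kovari-Sos-Turan
    count yields transitive [r]-sets [a] in [X] and [b] in [Y] with all edges from [a] to [b],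
    a large transitive set [da] in [X] preceding [a] and still dominating [b], and dually a large
    [db] in [Y].  Since [2 r >= k], the sequence [da a b db] is a [k]-th power of a path from [X]
    to [Y] although nothing is known between [da] and [db].  With [X] and [Y] the in- and
    out-neighbourhoods of a vertex [w], the vertex [w] can be placed between [a] and [b].

    Dense connections.  The set densely reachable from a linear-size set is almost closed, and
    the degree condition forces an almost closed set of linear size to have at least about [n/2]
    vertices.  So either any two linear-size sets are joined by short [k]-th powers of paths, or
    [V] splits into halves [A] and [B] with few edges from [B] to [A], and the only missing
    connections are those from [B] to [A].

    Assembly.  All but boundedly many vertices are partitioned into long transitive blocks whose
    two ends have linear-size common neighbourhoods.  The leftover vertices are wrapped in sparse
    segments; the blocks are joined densely through their interiors, except that each return from
    [B] to [A] uses a sparse segment.  The number of returns is governed by the set [Z] of vertices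
    with few out-neighbours in [A] and few in-neighbours in [B], and the degree condition supplies
    of order [n (s + |Z|)] edges for them. *)

Require Import Defs.
From mathcomp Require Import all_boot all_order all_algebra zify lra.
From mathcomp Require Import reals exp.
Set Implicit Arguments.
Unset Strict Implicit.
Unset Printing Implicit Defensive.

(** * Counting edges *)

Definition conv (V : finType) (e : rel V) : rel V := fun x y => e y x.

Definition nedges (V : finType) (e : rel V) (X Y : {set V}) : nat :=
  \sum_(x in X) \sum_(y in Y) e x y.

(* For [conv e] these are the common out-neighbours of [t] in [S]. *)
Definition dominators (V : finType) (e : rel V) (S : {set V}) (t : seq V) : {set V} :=
  [set x in S | all (e x) t].

Section Basic.
Context (V : finType).
Implicit Types (e : rel V) (X Y U W : {set V}).

Lemma tournament_conv e : tournament e -> tournament (conv e).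
Proof.
case=> irr tot; split=> [x|x y xy]; first exact: irr.
by rewrite /conv addbC; apply: tot.
Qed.

Lemma tournament_total e x y : tournament e -> x != y -> ~~ e x y -> e y x.
Proof. by case=> _ tot /tot; case: (e x y). Qed.

Lemma tournament_asym e x y : tournament e -> e x y -> e y x = false.
Proof.
case=> irr tot exy; have xy : x != y by apply: contraTneq exy => ->; rewrite irr.
by have := tot _ _ xy; rewrite exy; case: (e y x).
Qed.

Lemma nedges_conv e X Y : nedges (conv e) X Y = nedges e Y X.
Proof. by rewrite /nedges exchange_big. Qed.

Lemma nedges_card e X Y : nedges e X Y = \sum_(x in X) #|[set y in Y | e x y]|.
Proof.
apply: eq_bigr => x _; rewrite -sum1_card big_mkcond [RHS]big_mkcond /=.
by apply: eq_bigr => y _; rewrite inE; case: (y \in Y); case: (e x y).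
Qed.

Lemma nedges_card_r e X Y : nedges e X Y = \sum_(y in Y) #|[set x in X | e x y]|.
Proof. by rewrite -nedges_conv nedges_card. Qed.

Lemma nedges_leq_mul e X Y : nedges e X Y <= #|X| * #|Y|.
Proof.
rewrite nedges_card -sum_nat_const; apply: leq_sum => x _.
by apply/subset_leq_card/subsetP => y; rewrite inE => /andP[].
Qed.

Lemma nedgesS e X X' Y Y' : X \subset X' -> Y \subset Y' -> nedges e X Y <= nedges e X' Y'.
Proof.
move=> sX sY; rewrite !nedges_card [leqRHS](big_setID X) /= (setIidPr sX).
apply: leq_trans (leq_addr _ _); apply: leq_sum => x _.
by apply/subset_leq_card/subsetP => y; rewrite !inE => /andP[/(subsetP sY)-> ->].
Qed.

Lemma nedgesUl e X X' Y : nedges e (X :|: X') Y <= nedges e X Y + nedges e X' Y.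
Proof.
rewrite /nedges (big_setID X) /= setUK leq_add2l setDUl setDv set0U.
by apply: (nedgesS (Y := Y) e) => //; apply: subsetDl.
Qed.

Lemma nedgesUr e X Y Y' : nedges e X (Y :|: Y') <= nedges e X Y + nedges e X Y'.
Proof. by rewrite -!(nedges_conv e) nedgesUl. Qed.

Lemma nedges_disjoint_split e X Y Y' :
  [disjoint Y & Y'] -> nedges e X (Y :|: Y') = nedges e X Y + nedges e X Y'.
Proof.
move=> dis; rewrite /nedges -big_split /=; apply: eq_bigr => x _.
rewrite (big_setID Y) /= setUK setDUl setDv set0U.
by have /setDidPl-> : [disjoint Y' & Y] by rewrite disjoint_sym.
Qed.

Lemma nedges_both e X Y : tournament e -> [disjoint X & Y] ->
  nedges e X Y + nedges e Y X = #|X| * #|Y|.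
Proof.
move=> tT dis; rewrite -(nedges_conv e X Y) /nedges -big_split /= -sum_nat_const.
apply: eq_bigr => x xX; rewrite -big_split /= -sum1_card.
apply: eq_bigr => y yY; rewrite /conv.
have xy : x != y by apply: contraTneq yY => <-; rewrite (disjointFr dis).
by case: tT => _ /(_ _ _ xy); case: (e x y); case: (e y x).
Qed.

Lemma nedges_diag e U : tournament e -> (nedges e U U).*2 + #|U| = #|U| * #|U|.
Proof.
move=> tT; rewrite -addnn -{2}(nedges_conv e U U) /nedges -big_split /=.
rewrite -[RHS]sum_nat_const -[X in _ + X]sum1_card -big_split /=.
apply: eq_bigr => x xU; rewrite -big_split /= -[RHS]sum1_card.
rewrite (bigD1 x) //= [RHS](bigD1 x) //= addnAC addnC [RHS]addnC; congr (_ + _).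
  apply: eq_bigr => y /andP[_ yx]; rewrite /conv.
  by case: tT => _ /(_ _ _ yx); case: (e x y); case: (e y x).
by rewrite /conv; case: tT => ->.
Qed.

(** In the tournament induced on the set [U] of these vertices the in-degrees average (|U| - 1)/2,
    and each of them is below [m]. *)
Lemma card_low_indegree e W m : tournament e ->
  #|[set a in W | #|[set x in W | e x a]| < m]| <= 2 * m.
Proof.
move=> tT; set U := [set a in W | _].
have sUW : U \subset W by apply/subsetP => x; rewrite inE => /andP[].
have := nedges_diag U tT.
suff le_ec : nedges e U U + #|U| <= #|U| * m.
  have [->//|U0] := posnP #|U|.
  by rewrite -(leq_pmul2l U0); lia.
rewrite nedges_card_r -sum_nat_const -[X in _ + X]sum1_card -big_split /=.
apply: leq_sum => y; rewrite inE addn1 => /andP[_]; apply: leq_trans.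
rewrite ltnS; apply/subset_leq_card/subsetP => x.
by rewrite !inE => /andP[/andP[->]].
Qed.

End Basic.

(** * The power mean inequality *)

Lemma leq_expn2r r m n : m <= n -> m ^ r <= n ^ r.
Proof. by case: r => [|r] //; rewrite leq_exp2r. Qed.

(** Chebyshev's sum inequality: after symmetrising the double sums, each pair contributes x^r y +
    y^r x <= x^(r+1) + y^(r+1). *)
Lemma leq_mul_sum_pow (I : finType) (P : {set I}) (x : I -> nat) r :
  (\sum_(i in P) x i ^ r) * (\sum_(i in P) x i) <=
  #|P| * (\sum_(i in P) x i ^ r.+1).
Proof.
pose G i j := x i ^ r * x j; pose H (i j : I) := x i ^ r.+1.
have -> : (\sum_(i in P) x i ^ r) * (\sum_(i in P) x i) =
  \sum_(i in P) \sum_(j in P) G i j by rewrite big_distrlr.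
have -> : #|P| * (\sum_(i in P) x i ^ r.+1) = \sum_(i in P) \sum_(j in P) H i j.
  by rewrite /H exchange_big /= sum_nat_const.
rewrite -leq_double -!addnn [X in X + _ <= _]exchange_big [X in _ <= X + _]exchange_big.
rewrite -!big_split /=.
apply: leq_sum => i _; rewrite -!big_split /=; apply: leq_sum => j _.
rewrite /G /H !expnS; have [ab|/ltnW ba] := leqP (x i) (x j).
  by have := leq_expn2r r ab; nia.
by have := leq_expn2r r ba; nia.
Qed.

Lemma leq_sum_pow (I : finType) (P : {set I}) (x : I -> nat) r :
  (\sum_(i in P) x i) ^ r.+1 <= #|P| ^ r * (\sum_(i in P) x i ^ r.+1).
Proof.
elim: r => [|r IH]; first by rewrite !expn1 expn0 mul1n.
rewrite expnS (expnS #|P|); have := leq_mul_sum_pow P x r.+1.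
move: (\sum_(i in P) x i ^ r.+2) => s2 h.
have := leq_mul IH (leqnn (\sum_(i in P) x i)).
nia.
Qed.

(** * Transitive tuples *)

Lemma big_tuple_cons (V : finType) r (P : pred (r.+1.-tuple V)) F :
  \sum_(t | P t) F t =
  \sum_(a : V) \sum_(t : r.-tuple V | P [tuple of a :: t]) F [tuple of a :: t].
Proof.
rewrite pair_big_dep /= (reindex (fun p : V * r.-tuple V => [tuple of p.1 :: p.2])) //.
exists (fun t : r.+1.-tuple V => (thead t, [tuple of behead t])).
  by case=> a t _; congr (_, _); apply/val_inj.
by move=> t _; rewrite [RHS]tuple_eta; apply/val_inj.
Qed.

Definition all_tuples (V : finType) r (W : {set V}) : {set r.-tuple V} :=
  [set t : r.-tuple V | all [in W] t].

Definition trans_tuples (V : finType) (e : rel V) r (W : {set V}) : {set r.-tuple V} :=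
  [set t : r.-tuple V | pairwise e t && all [in W] t].

Section Count.
Context (V : finType).
Implicit Types (e : rel V) (X Y U W : {set V}).

Lemma card_all_tuples r W : #|all_tuples r W| = #|W| ^ r.
Proof.
elim: r => [|r IH].
  rewrite expn0; apply/eqP/cards1P; exists [tuple]; apply/setP => t.
  by rewrite !inE tuple0 eqxx.
rewrite expnS -sum1_card big_tuple_cons.
rewrite -[in RHS]IH -sum_nat_const [RHS]big_mkcond /=; apply: eq_bigr => a _.
case: ifP => aW; last by apply: big1 => t; rewrite inE /= aW.
by rewrite sum1dep_card; apply: eq_card => t; rewrite !inE /= aW.
Qed.

Lemma all_setI e W (a : V) (t : seq V) :
  all [in [set x in W | e a x]] t = all (e a) t && all [in W] t.
Proof.
by rewrite -all_predI; apply: eq_all => x; rewrite /= !inE andbC.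
Qed.

Lemma card_trans_tuplesS e r W :
  #|trans_tuples e r.+1 W| = \sum_(a in W) #|trans_tuples e r [set x in W | e a x]|.
Proof.
rewrite -sum1_card big_tuple_cons [RHS]big_mkcond /=; apply: eq_bigr => a _.
case: ifP => aW; last by apply: big1 => t; rewrite inE /= aW andbF.
rewrite sum1dep_card; apply: eq_card => t.
by rewrite !inE /= aW all_setI -andbA; case: (all _ _); case: (pairwise _ _).
Qed.

Lemma card_trans_tuples_leq e r W : #|trans_tuples e r W| <= #|W| ^ r.
Proof.
rewrite -card_all_tuples; apply/subset_leq_card/subsetP => t.
by rewrite !inE => /andP[].
Qed.

(** At least a quarter of [W] has at least about |W|/4 out-neighbours in [W]. Such a vertex is taken
    as the first entry and the tuple is continued inside its out-neighbourhood, which costs a factor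
    4 per entry. *)
Lemma card_trans_tuples_geq e r W : tournament e -> (#|W| %/ 4 ^ r) ^ r <= #|trans_tuples e r W|.
Proof.
move=> tT; elim: r W => [|r IH] W.
  rewrite expn0 card_gt0; apply/set0Pn; exists [tuple].
  by rewrite inE.
set w := #|W|; pose L := [set a in W | #|[set x in W | e a x]| < w %/ 4].
have cL : #|L| <= 2 * (w %/ 4) by apply: (card_low_indegree W (w %/ 4) (tournament_conv tT)).
have cD : w %/ 4 <= #|W :\: L|.
  by rewrite cardsD (setIidPr _) //; [move: cL; rewrite -/w; lia | apply/subsetP => x; rewrite inE => /andP[]].
rewrite card_trans_tuplesS (big_setID L) /=; apply: leq_trans (leq_addl _ _).
apply: (@leq_trans (\sum_(a in W :\: L) (w %/ 4 %/ 4 ^ r) ^ r)).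
  rewrite sum_nat_const expnS expnS divnMA leq_mul //.
  by apply: leq_trans (leq_div _ _) cD.
apply: leq_sum => a; rewrite !inE negb_and -leqNgt => /andP[/orP[/negbTE->//|h] aW].
by apply: leq_trans (IH _); apply/leq_expn2r/leq_div2r.
Qed.

Lemma transitive_seq e r W : tournament e -> 4 ^ r <= #|W| ->
  exists t : seq V, [/\ size t = r, pairwise e t & {subset t <= W}].
Proof.
move=> tT hW; have := card_trans_tuples_geq r W tT.
have : 0 < (#|W| %/ 4 ^ r) ^ r by rewrite expn_gt0 divn_gt0 ?expn_gt0 // hW.
move=> h1 h2; have /card_gt0P[t] := leq_trans h1 h2.
rewrite inE => /andP[pt /allP aW]; exists t; split=> //.
by rewrite size_tuple.
Qed.

Lemma leq_divn_double w d : 0 < d -> d <= w -> w <= 2 * d * (w %/ d).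
Proof.
move=> d0 dw; rewrite {1}(divn_eq w d).
have := ltn_pmod w d0; have : 0 < w %/ d by rewrite divn_gt0.
nia.
Qed.

Lemma pow_leq_card_trans_tuples e r W : tournament e ->
  #|W| ^ r <= (2 * 4 ^ r) ^ r * #|trans_tuples e r W| + (4 ^ r) ^ r.
Proof.
move=> tT; have [lt|ge] := ltnP #|W| (4 ^ r).
  by apply: leq_trans (leq_addl _ _); apply/leq_expn2r/ltnW.
apply: leq_trans (leq_addr _ _).
apply: leq_trans (leq_mul (leqnn _) (card_trans_tuples_geq r W tT)).
by rewrite -expnMn; apply/leq_expn2r/leq_divn_double; rewrite ?expn_gt0.
Qed.

(** The tuples have order |W|^(r+1) against |W|^r on the left, so only sets of bounded size require
    the constant correction. *)
Lemma pow_leq_card_trans_tuplesS e r W K : tournament e ->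
  K * #|W| ^ r <= #|trans_tuples e r.+1 W| + K * (K * (2 * 4 ^ r.+1) ^ r.+1) ^ r.
Proof.
move=> tT; pose P := K * (2 * 4 ^ r.+1) ^ r.+1; have [lt|ge] := ltnP #|W| P.
  by apply: leq_trans (leq_addl _ _); rewrite leq_mul // leq_expn2r // ltnW.
apply: leq_trans (leq_addr _ _).
have [->//|K0] := posnP K.
have d0 : 0 < 4 ^ r.+1 by rewrite expn_gt0.
have c0 : 0 < (2 * 4 ^ r.+1) ^ r.+1 by rewrite expn_gt0 muln_gt0 d0.
have dw : 4 ^ r.+1 <= #|W|.
  have : 2 * 4 ^ r.+1 <= (2 * 4 ^ r.+1) ^ r.+1.
    by rewrite -[leqLHS]expn1 leq_pexp2l // muln_gt0 d0.
  by move: ge; rewrite /P; nia.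
rewrite -(leq_pmul2l c0).
apply: leq_trans (leq_mul (leqnn _) (card_trans_tuples_geq r.+1 W tT)).
rewrite -expnMn.
apply: leq_trans (leq_expn2r r.+1 (leq_divn_double d0 dw)).
by rewrite [leqRHS]expnS mulnA leq_mul // mulnC.
Qed.

(** With the last [r] entries [t] fixed, the first entry has fewer than [M] in-neighbours in the
    tournament on [dominators e W t], which leaves at most [2 * M] choices for it. *)
Lemma card_few_dominators e r W M : tournament e ->
  #|[set t in trans_tuples e r.+1 W | #|dominators e W t| < M]| <= 2 * M * #|W| ^ r.
Proof.
move=> tT; rewrite -sum1_card big_tuple_cons.
rewrite (exchange_big_dep (mem (trans_tuples e r W))) /=; last first.
  move=> a t _; rewrite !inE /= => /andP[/andP[/andP[_ ->]]].
  by case/andP.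
apply: leq_trans (leq_mul (leqnn _) (card_trans_tuples_leq e r W)).
rewrite mulnC -sum_nat_const; apply: leq_sum => t _.
rewrite sum1dep_card; apply: leq_trans (card_low_indegree (dominators e W t) M tT).
apply/subset_leq_card/subsetP => a; rewrite !inE /=.
case/andP=> /andP[/andP[aet _] /andP[aW _]] small; rewrite aW aet /=.
apply: leq_trans small; rewrite ltnS; apply/subset_leq_card/subsetP => x.
by rewrite /dominators !inE /=; case: (x \in W); case: (e x a); rewrite ?andbT ?andbF.
Qed.

End Count.

(** * The sparse lemma *)

Lemma pairwise_conv_rev (V : finType) (e : rel V) s :
  pairwise e (rev s) = pairwise (conv e) s.
Proof.
elim: s => // x s IH; rewrite rev_cons -cats1 pairwise_cat IH /= andbT.
by rewrite allrel1r all_rev.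
Qed.

Section Sparse.
Context (V : finType).
Implicit Types (e : rel V) (X Y U W : {set V}).

Lemma all_dominators e W (s t : seq V) :
  all [in dominators e W s] t = all [in W] t && allrel e t s.
Proof. by rewrite /allrel -all_predI; apply: eq_all => x; rewrite !inE. Qed.

Lemma mem_trans_tuples_dominators e e' r W (s : seq V) (t : r.-tuple V) :
  (t \in trans_tuples e' r (dominators e W s)) = (t \in trans_tuples e' r W) && allrel e t s.
Proof. by rewrite !inE all_dominators andbA. Qed.

Lemma mem_all_tuples_dominators e r W (s : seq V) (t : r.-tuple V) :
  (t \in all_tuples r (dominators e W s)) = (t \in all_tuples r W) && allrel e t s.
Proof. by rewrite !inE all_dominators. Qed.

Lemma sum_card_exchange (I J : finType) (A : {set I}) (B : {set J}) (R : I -> J -> bool) :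
  \sum_(i in A) #|[set j in B | R i j]| = \sum_(j in B) #|[set i in A | R i j]|.
Proof.
have E (i : I) : i \in A -> #|[set j in B | R i j]| = \sum_(j in B) R i j.
  move=> _; rewrite -sum1_card big_mkcond [RHS]big_mkcond /=; apply: eq_bigr => j _.
  by rewrite inE; case: (j \in B); case: (R i j).
rewrite (eq_bigr _ E) exchange_big /=; apply: eq_bigr => j _.
rewrite -sum1_card big_mkcond [RHS]big_mkcond /=; apply: eq_bigr => i _.
by rewrite inE; case: (i \in A); case: (R i j).
Qed.

(** Double counting of stars with the power mean inequality applied twice: to the in-degrees of the
    vertices of [Y], then to the numbers of common out-neighbours of the tuples in [X]. *)
Lemma pow_nedges_leq e r X Y :
  nedges e X Y ^ (r.+1 * r.+1) <=
  #|V| ^ (2 * r * r.+1) * \sum_(A in all_tuples r.+1 X) #|dominators (conv e) Y A| ^ r.+1.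
Proof.
pose S := \sum_(A in all_tuples r.+1 X) #|dominators (conv e) Y A|.
have h1 : nedges e X Y ^ r.+1 <= #|V| ^ r * S.
  have -> : S = \sum_(y in Y) #|[set x in X | e x y]| ^ r.+1.
    rewrite /S; transitivity (\sum_(y in Y) #|[set A in all_tuples r.+1 X | all (e^~ y) A]|).
      rewrite -sum_card_exchange; apply: eq_bigr => A _; apply: eq_card => y.
      by rewrite !inE.
    apply: eq_bigr => y _; rewrite -card_all_tuples; apply: eq_card => A; rewrite !inE.
    by rewrite -all_predI; apply: eq_all => x; rewrite /= inE.
  rewrite nedges_card_r; apply: leq_trans (leq_sum_pow _ _ _) _.
  by rewrite leq_mul // leq_expn2r // max_card.
have h2 : S ^ r.+1 <= (#|V| ^ r.+1) ^ r * \sum_(A in all_tuples r.+1 X) #|dominators (conv e) Y A| ^ r.+1.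
  apply: leq_trans (leq_sum_pow _ _ _) _.
  by rewrite card_all_tuples leq_mul // leq_expn2r // leq_expn2r // max_card.
rewrite expnM; apply: leq_trans (leq_expn2r r.+1 h1) _.
rewrite expnMn -expnM; apply: leq_trans (leq_mul (leqnn _) h2) _.
by rewrite mulnA -expnM -expnD leq_mul // eq_leq //; congr (_ ^ _); lia.
Qed.

(* The second component is listed in reverse order, so that reversing all edges and
   exchanging [X] with [Y] just exchanges the two components. *)
Definition trans_pairs e r X Y : {set r.-tuple V * r.-tuple V} :=
  [set p | [&& p.1 \in trans_tuples e r X, p.2 \in trans_tuples (conv e) r Y & allrel e p.1 p.2]].

Lemma card_trans_pairs e r X Y :
  #|trans_pairs e r X Y| = \sum_(B in trans_tuples (conv e) r Y) #|trans_tuples e r (dominators e X B)|.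
Proof.
rewrite -sum1_card.
rewrite (eq_bigl (fun p => (p.2 \in trans_tuples (conv e) r Y) && (p.1 \in trans_tuples e r (dominators e X p.2)))).
  rewrite (reindex (fun p : r.-tuple V * r.-tuple V => (p.2, p.1))) /=; last first.
    by exists (fun p => (p.2, p.1)) => -[].
  rewrite -(pair_big_dep (fun B => B \in trans_tuples (conv e) r Y)
    (fun B A => A \in trans_tuples e r (dominators e X B)) (fun _ _ => 1)) /=.
  by apply: eq_bigr => B _; rewrite sum1_card.
move=> [A B]; rewrite mem_trans_tuples_dominators /= inE /=.
by rewrite andbCA.
Qed.

Lemma card_trans_pairs_conv e r X Y : #|trans_pairs (conv e) r Y X| = #|trans_pairs e r X Y|.
Proof.
rewrite -!sum1_card (reindex (fun p : r.-tuple V * r.-tuple V => (p.2, p.1))) /=; last first.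
  by exists (fun p => (p.2, p.1)) => -[].
apply: eq_bigl => -[A B]; rewrite inE [RHS]inE /= [X in [&& _, _ & X]]allrelC.
exact: andbCA.
Qed.

Definition weak_pairs e r M X Y : {set r.-tuple V * r.-tuple V} :=
  [set p in trans_pairs e r X Y | #|dominators e (dominators e X p.2) p.1| < M].

Lemma mem_weak_pairs e r M X Y p : (p \in weak_pairs e r M X Y) =
  (p \in trans_pairs e r X Y) && (#|dominators e (dominators e X p.2) p.1| < M).
Proof. by rewrite [LHS]inE. Qed.

Lemma card_weak_pairs e r M X Y : tournament e ->
  #|weak_pairs e r.+1 M X Y| <=
  \sum_(B in trans_tuples (conv e) r.+1 Y) 2 * M * #|dominators e X B| ^ r.
Proof.
move=> tT; rewrite -sum1_card.
rewrite (eq_bigl (fun p => (p.2 \in trans_tuples (conv e) r.+1 Y) &&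
  (p.1 \in [set t in trans_tuples e r.+1 (dominators e X p.2) | #|dominators e (dominators e X p.2) t| < M]))).
  rewrite (reindex (fun p : r.+1.-tuple V * r.+1.-tuple V => (p.2, p.1))) /=; last first.
    by exists (fun p => (p.2, p.1)) => -[].
  rewrite -(pair_big_dep (fun B => B \in trans_tuples (conv e) r.+1 Y)
    (fun B A => A \in [set t in trans_tuples e r.+1 (dominators e X B) | #|dominators e (dominators e X B) t| < M])
    (fun _ _ => 1)) /=.
  by apply: leq_sum => B _; rewrite sum1_card card_few_dominators.
move=> [A B] /=; rewrite inE [X in _ = _ && X]inE mem_trans_tuples_dominators [X in X && _ = _]inE /=.
by rewrite !andbA; congr (_ && _ && _); rewrite andbC.
Qed.

(** If the second tuple has d dominators, the weak first tuples have order d^r against d^(r+1) for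
    all transitive ones. The factor 4 allows for the weak pairs of both sides at once. *)
Lemma card_weak_pairs4 e r M X Y : tournament e ->
  4 * #|weak_pairs e r.+1 M X Y| <=
  #|trans_pairs e r.+1 X Y| +
  8 * M * (8 * M * (2 * 4 ^ r.+1) ^ r.+1) ^ r * #|V| ^ r.+1.
Proof.
move=> tT; apply: leq_trans (leq_mul (leqnn _) (card_weak_pairs r M X Y tT)) _.
set K := 8 * M; rewrite card_trans_pairs big_distrr /=.
have cY : #|trans_tuples (conv e) r.+1 Y| <= #|V| ^ r.+1.
  by apply: leq_trans (card_trans_tuples_leq _ _ _) _; rewrite leq_expn2r // max_card.
apply: leq_trans (leq_add (leqnn _) (leq_mul (leqnn _) cY)).
rewrite [X in _ + X]mulnC -sum_nat_const -big_split /=; apply: leq_sum => B _.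
by rewrite !mulnA; apply: pow_leq_card_trans_tuplesS.
Qed.

(** Transitivity is imposed on one tuple at a time: first on [B] among the common out-neighbours of
    an arbitrary [A], then, after exchanging the sums, on [A] among the dominators of a transitive
    [B]. *)
Lemma pow_nedges_leq_trans_pairs e r X Y : tournament e ->
  nedges e X Y ^ (r.+1 * r.+1) <= #|V| ^ (2 * r * r.+1) *
    (((2 * 4 ^ r.+1) ^ r.+1) ^ 2 * #|trans_pairs e r.+1 X Y| +
     ((2 * 4 ^ r.+1) ^ r.+1 + 1) * (4 ^ r.+1) ^ r.+1 * #|V| ^ r.+1).
Proof.
move=> tT; apply: leq_trans (pow_nedges_leq _ _ _ _) _; rewrite leq_mul //.
set c := (2 * _) ^ _; set c' := (4 ^ _) ^ _; set N := #|V| ^ _.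
have bd (I : finType) (A : {set I}) (e' : rel V) (tT' : tournament e') (W : I -> {set V}) : #|A| <= N ->
   \sum_(i in A) #|W i| ^ r.+1 <= c * (\sum_(i in A) #|trans_tuples e' r.+1 (W i)|) + c' * N.
  move=> AN; apply: leq_trans (leq_add (leqnn _) (leq_mul (leqnn _) AN)).
  rewrite [X in _ + X]mulnC -sum_nat_const big_distrr -big_split /=.
  by apply: leq_sum => i _; apply: pow_leq_card_trans_tuples.
have cX : #|all_tuples r.+1 X| <= N by rewrite card_all_tuples leq_expn2r // max_card.
have cY : #|trans_tuples (conv e) r.+1 Y| <= N.
  by apply: leq_trans (card_trans_tuples_leq _ _ _) _; rewrite leq_expn2r // max_card.
apply: leq_trans (bd _ _ _ (tournament_conv tT) _ cX) _.
have -> : \sum_(A in all_tuples r.+1 X) #|trans_tuples (conv e) r.+1 (dominators (conv e) Y A)| =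
  \sum_(B in trans_tuples (conv e) r.+1 Y) #|dominators e X B| ^ r.+1.
  transitivity (\sum_(A in all_tuples r.+1 X) #|[set B in trans_tuples (conv e) r.+1 Y | allrel e A B]|).
    apply: eq_bigr => A _; apply: eq_card => B.
    by rewrite mem_trans_tuples_dominators [RHS]inE [in RHS]allrelC.
  rewrite sum_card_exchange; apply: eq_bigr => B _; rewrite -card_all_tuples; apply: eq_card => A.
  by rewrite mem_all_tuples_dominators [LHS]inE.
apply: leq_trans (leq_add (leq_mul (leqnn _) (bd _ _ _ tT _ cY)) (leqnn _)) _.
rewrite -card_trans_pairs; move: (#|trans_pairs _ _ _ _|) => q.
rewrite -mulnn; nia.
Qed.

End Sparse.

(* Among the complete pairs of transitive [r.+1]-tuples, fewer than half have few
   dominators on either side. *)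
Lemma sparse_gadget r m : exists C : nat, forall (V : finType) (e : rel V) (X Y : {set V}),
  tournament e -> 0 < #|V| -> C * #|V| ^ (2 * r + 1) <= nedges e X Y ^ r.+1 ->
  exists da a b db : seq V,
    [/\ size a = r.+1, size b = r.+1, size da = m & size db = m] /\
    [/\ pairwise e (da ++ a), pairwise e (b ++ db),
        {subset da ++ a <= X}, {subset b ++ db <= Y} &
        allrel e da b /\ allrel e a (b ++ db)].
Proof.
pose M := 4 ^ m; pose K := 8 * M * (8 * M * (2 * 4 ^ r.+1) ^ r.+1) ^ r.
pose c := (2 * 4 ^ r.+1) ^ r.+1; pose c' := (4 ^ r.+1) ^ r.+1.
exists (c ^ 2 * K + (c + 1) * c' + 1) => V e X Y tT n0 hC.
set C := c ^ 2 * K + _ + 1 in hC; set n := #|V| in n0 hC.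
have N0 : 0 < n ^ r.+1 by rewrite expn_gt0 n0.
(* The hypothesis raised to the power [r.+1] meets the upper bound on the edge count;
   [n ^ (2 * r * r.+1)] cancels, and [C] is chosen so that the pairs outnumber the error term of
   [card_weak_pairs4]. *)
have big : K * n ^ r.+1 < #|trans_pairs e r.+1 X Y|.
  have := leq_trans (leq_expn2r r.+1 hC); rewrite -expnM => /(_ _ (pow_nedges_leq_trans_pairs r X Y tT)).
  rewrite expnMn -expnM -/n -/c -/c'.
  have -> : n ^ ((2 * r + 1) * r.+1) = n ^ (2 * r * r.+1) * n ^ r.+1.
    by rewrite -expnD; congr (_ ^ _); lia.
  rewrite mulnCA leq_pmul2l ?expn_gt0 ?n0 // => h.
  have CC : C <= C ^ r.+1 by rewrite -{1}(expn1 C) leq_pexp2l // /C addn1.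
  have {h CC} := leq_trans (leq_mul CC (leqnn (n ^ r.+1))) h.
  rewrite /C; have c0 : 0 < c ^ 2 by rewrite !expn_gt0 muln_gt0 expn_gt0.
  move: (#|trans_pairs e r.+1 X Y|) (n ^ r.+1) N0 (c ^ 2) c0 => q N N0 c2 c0 h.
  rewrite ltnNge; apply/negP => qK.
  have := leq_mul (leqnn c2) qK; nia.
have [p pQ ngood] : exists2 p, p \in trans_pairs e r.+1 X Y &
   (p \notin weak_pairs e r.+1 M X Y) &&
   ((p.2, p.1) \notin weak_pairs (conv e) r.+1 M Y X).
  pose sw (p : r.+1.-tuple V * r.+1.-tuple V) := (p.2, p.1).
  pose B := weak_pairs e r.+1 M X Y :|: [set sw q | q in weak_pairs (conv e) r.+1 M Y X].
  have cB : #|B| < #|trans_pairs e r.+1 X Y|.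
    have := card_weak_pairs4 r M X Y tT.
    have := card_weak_pairs4 r M Y X (tournament_conv tT).
    rewrite card_trans_pairs_conv -/n -/K => h2 h1.
    have : #|B| <= #|weak_pairs e r.+1 M X Y| + #|weak_pairs (conv e) r.+1 M Y X|.
      by apply: leq_trans (leq_card_setU _ _) _; rewrite leq_add2l leq_imset_card.
    lia.
  have : 0 < #|trans_pairs e r.+1 X Y :\: B|.
    rewrite cardsD subn_gt0; apply: leq_ltn_trans cB.
    by apply/subset_leq_card/subsetIr.
  case/card_gt0P=> p; rewrite inE => /andP[pB pQ]; exists p => //.
  move: pB; rewrite inE negb_or => /andP[-> /= h]; apply: contra h => h.
  by apply/imsetP; exists (sw p) => //; case: (p).
case: p pQ ngood => A B /= pQ.
have pQ' : (B, A) \in trans_pairs (conv e) r.+1 Y X.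
  by move: pQ; rewrite !inE /= => /and3P[-> -> AB]; rewrite allrelC.
rewrite !mem_weak_pairs pQ pQ' /= -!leqNgt.
case/andP=> hA hB.
have [da [sda pda dasub]] := transitive_seq tT hA.
have [db [sdb pdb dbsub]] := transitive_seq (tournament_conv tT) hB.
move: pQ; rewrite !inE /= => /and3P[/andP[pA /allP AX] /andP[pB /allP BY] AB].
(* [B] and [db] are transitive for the reversed relation, hence the reversals. *)
exists da, A, (rev B), (rev db).
rewrite size_rev !size_tuple size_rev; split=> //.
have daX x : x \in da -> x \in X by move/dasub; rewrite !inE => /andP[/andP[]].
have dbY x : x \in db -> x \in Y by move/dbsub; rewrite !inE => /andP[/andP[]].
have daA : allrel e da A.
  by apply/allrelP => x y /dasub; rewrite !inE => /andP[_ /allP h] /h.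
have daB : allrel e da B.
  by apply/allrelP => x y /dasub; rewrite !inE => /andP[/andP[_ /allP h] _] /h.
have dbB : allrel (conv e) db B.
  by apply/allrelP => x y /dbsub; rewrite !inE => /andP[_ /allP h] /h.
have dbA : allrel (conv e) db A.
  by apply/allrelP => x y /dbsub; rewrite !inE => /andP[/andP[_ /allP h] _] /h.
split.
- by rewrite pairwise_cat daA pda.
- by rewrite -rev_cat pairwise_conv_rev pairwise_cat dbB pdb.
- by move=> x; rewrite mem_cat => /orP[/daX|/AX].
- by move=> x; rewrite -rev_cat mem_rev mem_cat => /orP[/dbY|/BY].
- split; apply/allrelP => x y xd; first by rewrite mem_rev => yB; apply: (allrelP daB).
  rewrite -rev_cat mem_rev mem_cat => /orP[yd|yB]; last exact: (allrelP AB).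
  exact: (allrelP dbA).
Qed.

(** * Powers of paths and dense reachability *)

Definition lastk (T : Type) k (p : seq T) := drop (size p - k) p.

Fixpoint kpath (V : finType) (e : rel V) k (p : seq V) : bool :=
  if p is x :: p' then all (e x) (take k p') && kpath e k p' else true.

Section KPath.
Context (V : finType) (e : rel V) (k : nat).
Implicit Types p q : seq V.

Lemma mem_lastk p : {subset lastk k p <= p}.
Proof. by move=> x /mem_drop. Qed.

Lemma lastk_cat p q : k <= size q -> lastk k (p ++ q) = lastk k q.
Proof.
move=> kq; rewrite /lastk size_cat drop_cat ifF; last by apply/negbTE; lia.
by congr drop; lia.
Qed.

Lemma lastk_id p : size p <= k -> lastk k p = p.
Proof. by move=> h; rewrite /lastk (eqP h) drop0. Qed.

Lemma take_cat_leq p q : k <= size p -> take k (p ++ q) = take k p.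
Proof.
move=> kp; rewrite take_cat; case: ltnP => // h.
have -> : k = size p by apply/eqP; rewrite eqn_leq kp.
by rewrite subnn take0 cats0 take_size.
Qed.

Lemma pairwise_kpath p : pairwise e p -> kpath e k p.
Proof.
elim: p => //= x p IH /andP[/allP h /IH ->]; rewrite andbT.
by apply/allP => y /mem_take /h.
Qed.

Lemma kpath_cat p q : kpath e k p -> kpath e k q ->
  allrel e (lastk k p) (take k q) -> kpath e k (p ++ q).
Proof.
elim: p => //= x p IH /andP[/allP hx hp] hq hpq.
rewrite {}IH //; last first.
  apply/allrelP => y z yp zq; apply: (allrelP hpq) => //.
  move: yp; rewrite /lastk /=; case: (leqP k (size p)) => kp.
    by rewrite subSn.
  have -> : size p - k = 0 by lia.
  have -> : (size p).+1 - k = 0 by lia.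
  by rewrite !drop0 inE => ->; rewrite orbT.
rewrite andbT; apply/allP => y; rewrite take_cat; case: ltnP => kp.
  by move=> yp; apply: hx.
rewrite mem_cat => /orP[yp|yq]; first by apply: hx; rewrite take_oversize.
apply: (allrelP hpq); last first.
  by move: yq; rewrite -(take_takel q (leq_subr (size p) k)) => /mem_take.
have k1 : size p < k.
  by rewrite -subn_gt0; move: yq; case: (k - size p) => //; rewrite take0.
rewrite lastk_id ?mem_head //.
Qed.

Lemma kpath_nth x0 p i j :
  kpath e k p -> i < j -> j <= i + k -> j < size p -> e (nth x0 p i) (nth x0 p j).
Proof.
elim: p i j => //= x p IH [|i] [|j] //= /andP[/allP h hp] ij jk js; last exact: IH.
have jk' : j < k by rewrite add0n in jk.
apply: h; rewrite -(nth_take x0 jk') mem_nth // size_take.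
by case: (k < _).
Qed.

(* The vertices of [dL] and those of [dR] need not be related: they are more than [k] apart. *)
Lemma kpath_bridge (dL c dR : seq V) : k <= size c ->
  pairwise e dL -> pairwise e (c ++ dR) -> allrel e dL c -> kpath e k (dL ++ c ++ dR).
Proof.
move=> kc; elim: dL => [|x dL IH] /=; first by move=> _ /pairwise_kpath.
case/andP=> /allP xd pd pc; rewrite allrel_consl => /andP[/allP xc dc].
rewrite IH // andbT; apply/allP => y; rewrite catA take_cat_leq ?size_cat; last lia.
by move/mem_take; rewrite mem_cat => /orP[/xd|/xc].
Qed.

End KPath.

Lemma leq_card_bigcup (I T : finType) (P : pred I) (F : I -> {set T}) :
  #|\bigcup_(i | P i) F i| <= \sum_(i | P i) #|F i|.
Proof.
elim/big_rec2: _ => [|i m A _ h]; first by rewrite cards0.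
by apply: leq_trans (leq_card_setU _ _) _; rewrite leq_add2l.
Qed.

(** By averaging, linearly many vertices of [S] dominate at least [K] of [N] vertices of [t]. Only
    [2 ^ N] subfamilies exist, so by pigeonhole linearly many of these vertices dominate the same
    [K]. *)
Lemma pick_common K q : exists N g, forall (V : finType) (R : rel V) (S : {set V}) (t : seq V),
  0 < #|V| -> N <= size t ->
  (forall y, y \in t -> #|V| <= q * #|[set x in S | R x y]|) ->
  exists u, [/\ size u = K, subseq u t & #|V| <= g * #|dominators R S u|].
Proof.
(* With [N > 2 * q * K], the vertices dominating fewer than [K] entries account for less than half
   of the N n / q guaranteed incidences. The factor [2 ^ N] in [g] counts the masks. *)
pose N := 2 * q * K + 1; pose g := 2 * q * 2 ^ N; exists N, g => V R S t0 n0 st0 ht0.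
pose t := take N t0; have st : size t = N by rewrite size_takel.
have ht y : y \in t -> #|V| <= q * #|[set x in S | R x y]| by move/mem_take/ht0.
suff [u [su ut hu]] : exists u, [/\ size u = K, subseq u t & #|V| <= g * #|dominators R S u|].
  by exists u; split=> //; apply: subseq_trans ut (take_subseq _ _).
pose G := [set x in S | K <= count (R x) t]; set n := #|V| in n0 ht *.
have hG : n <= 2 * q * #|G|.
  have h1 : N * n <= q * \sum_(x in S) count (R x) t.
    have -> : \sum_(x in S) count (R x) t = \sum_(y <- t) #|[set x in S | R x y]|.
      transitivity (\sum_(x in S) \sum_(y <- t) R x y).
        by apply: eq_bigr => x _; rewrite -sum1_count big_mkcond.
      rewrite exchange_big /=; apply: eq_bigr => y _.
      rewrite -sum1_card big_mkcond [RHS]big_mkcond /=; apply: eq_bigr => x _.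
      by rewrite inE; case: (x \in S); case: (R x y).
    rewrite big_distrr /= -st -sum1_size big_distrl /= !big_seq.
    by apply: leq_sum => y /ht; rewrite mul1n.
  have h2 : \sum_(x in S) count (R x) t <= #|G| * N + n * K.
    rewrite (big_setID G) /= leq_add //.
      apply: leq_trans (_ : \sum_(x in G) N <= _); last by rewrite sum_nat_const.
      rewrite (_ : S :&: G = G); last by apply/setP => x; rewrite !inE andbA andbb.
      by apply: leq_sum => x _; rewrite -st count_size.
    apply: leq_trans (_ : \sum_(x in S :\: G) K <= _).
      by apply: leq_sum => x; rewrite !inE; case: (x \in S); rewrite ?andbF //= andbT -ltnNge; apply: ltnW.
    by rewrite sum_nat_const leq_mul // max_card.
  have N0 : 0 < N by rewrite /N addn1.
  rewrite -(leq_pmul2l N0); move: h1 h2; rewrite /N; nia.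
have [/existsP[m /andP[/eqP sm hm]]|] := boolP [exists m : N.-tuple bool,
   (size (mask m t) == K) && (n <= g * #|dominators R S (mask m t)|)].
  by exists (mask m t); rewrite mask_subseq.
rewrite negb_exists => /forallP none.
have sub : G \subset \bigcup_(m : N.-tuple bool | size (mask m t) == K) dominators R S (mask m t).
  apply/subsetP => x; rewrite inE => /andP[xS xc].
  have /subseqP[m /eqP sm em] : subseq (take K (filter (R x) t)) t.
    exact: subseq_trans (take_subseq _ _) (filter_subseq _ _).
  rewrite st in sm; apply/bigcupP; exists (Tuple sm); rewrite /= -em.
    by rewrite size_takel // size_filter.
  rewrite inE xS /=; apply/allP => y /mem_take; by rewrite mem_filter => /andP[].
have h3 : g * #|G| <= 2 ^ N * n.-1.
  apply: leq_trans (leq_mul (leqnn g) (subset_leq_card sub)) _.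
  apply: (@leq_trans (\sum_(m : N.-tuple bool) n.-1)); last first.
    by rewrite sum_nat_const card_tuple card_bool.
  apply: leq_trans (leq_mul (leqnn g) (leq_card_bigcup _ _)) _.
  rewrite big_distrr big_mkcond /=; apply: leq_sum => m _.
  case: ifP => // Pm; have := none m; rewrite Pm /= -ltnNge.
  by move: n0; case: (n).
have := leq_mul (leqnn (2 ^ N)) hG; have : 0 < 2 ^ N by rewrite expn_gt0.
by move: h3; rewrite /g; move: (2 ^ N) => a; nia.
Qed.

(** Quantifying over [F] lets connections be chosen one after another, each avoiding everything
    already placed. *)
Definition linked (V : finType) (e : rel V) k phi l (W W' : {set V}) : Prop :=
  forall F : {set V}, phi * #|F| <= #|V| ->
  exists Q : seq V,
    [/\ uniq Q, kpath e k Q, k <= size Q <= l & {in Q, forall x, x \notin F}] /\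
    {subset take k Q <= W} /\ {subset lastk k Q <= W'}.

(** [W] is enlarged repeatedly by the vertices with at least n/q in-neighbours in the current set.
    One of the first [q] enlargements adds at most n/q vertices, and the set before it sends few
    edges outside: few outside vertices receive many edges, the others receive few. Paths are traced
    backwards through the layers. *)
Lemma reach k q : 0 < q -> exists phi l n0, forall (V : finType) (e : rel V),
  tournament e -> n0 <= #|V| -> forall W : {set V}, exists X : {set V},
    [/\ W \subset X, q * nedges e X (~: X) <= 2 * (#|V| * #|V|) &
        forall W' : {set V}, #|V| <= q * #|W' :&: X| -> linked e k phi l W W'].
Proof.
move=> q0; have [N [g0 pick]] := pick_common k q.
pose g := g0 + q; pose N' := N + k; pose c := g * q.+1.
exists (2 * c), (k * q.+1), (2 * c * 4 ^ N' + 1) => V e tT hn W.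
set n := #|V| in hn *; have n0 : 0 < n by move: hn; rewrite addn1; apply: leq_ltn_trans.
pose step (S : {set V}) := S :|: [set y | n <= q * #|[set x in S | e x y]|].
pose S i := iter i step W.
have Ssub i : S i \subset S i.+1 by rewrite [S i.+1]/= subsetUl.
have WS i : W \subset S i by elim: i => // i IH; apply: subset_trans IH (Ssub i).
have [i iq hi] : exists2 i, i < q & q * #|S i.+1 :\: S i| <= n.
  have [/existsP[i hi]|] := boolP [exists i : 'I_q, q * #|S i.+1 :\: S i| <= n].
    by exists i.
  rewrite negb_exists => /forallP none.
  have grow i : i <= q -> i * n.+1 <= q * #|S i|.
    elim: i => // i IH iq; have := none (Ordinal iq); rewrite -ltnNge /= => h.
    have := IH (ltnW iq); rewrite -(cardsID (S i) (S i.+1)) (setIidPr (Ssub i)).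
    by move=> h2; rewrite mulnDr mulSn addnC; apply: leq_add.
  have := grow q (leqnn q); have : #|S q| <= n by apply: max_card.
  by nia.
exists (S i); split=> //.
  rewrite nedges_card_r (big_setID (S i.+1)) /= mulnDr mul2n -addnn leq_add //.
    rewrite (_ : ~: S i :&: S i.+1 = S i.+1 :\: S i); last by apply/setP => x; rewrite !inE.
    apply: leq_trans (leq_mul hi (leqnn n)); rewrite -mulnA leq_mul //.
    by rewrite -sum_nat_const; apply: leq_sum => y _; apply: max_card.
  rewrite big_distrr /=; apply: (@leq_trans (\sum_(y in ~: S i :\: S i.+1) n)).
    by apply: leq_sum => y; rewrite !inE negb_or -ltnNge => /andP[/andP[_ /ltnW]].
  by rewrite sum_nat_const leq_mul // max_card.
move=> W' hW' F hF.
(* Any [t] vertices contain a transitive set of size [N'] outside [F]. Since [phi] is [2 * c], even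
   a linear-size [F] leaves [c * t <= n]. *)
pose t := #|F| + 4 ^ N'.
have ct : c * t <= n.
  move: hn hF; rewrite /t mulnDr -/n; move: (4 ^ N') => a; lia.
have big (U : {set V}) : t <= #|U| ->
    exists d, [/\ size d = N', pairwise e d, {subset d <= U} & {in d, forall x, x \notin F}].
  move=> hU; have [|d [sd pd dU]] := @transitive_seq V e N' (U :\: F) tT.
    by rewrite cardsD; have := subset_leq_card (subsetIr U F); move: hU; rewrite /t; lia.
  by exists d; split=> // x /dU; rewrite inE => /andP[].
(* Induction over the layers. Confining [Q] to [S j] keeps it disjoint from the [k] vertices taken
   in the next layer; the threshold [t * j.+1] ensures that [U] is large on the earlier layers or
   has [t] vertices in the new one. *)
have key j (U : {set V}) : j <= q -> t * j.+1 <= #|U :&: S j| -> exists Q : seq V,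
    [/\ uniq Q, kpath e k Q, k <= size Q <= k * j.+1, {in Q, forall x, x \notin F} &
        {subset Q <= S j}] /\ {subset take k Q <= W} /\ {subset lastk k Q <= U}.
  have uniqp d : pairwise e d -> uniq d.
    by apply: pairwise_uniq; case: tT.
  elim: j U => [|j IH] U jq.
    rewrite muln1 => /big[d [sd pd dU dF]]; exists (take k d).
    have st : size (take k d) = k by rewrite size_takel // sd leq_addl.
    have dU' x : x \in take k d -> x \in U :&: W by move/mem_take/dU.
    have ptk : pairwise e (take k d) by apply: subseq_pairwise pd; apply: take_subseq.
    split; first split.
    - exact: uniqp.
    - exact: pairwise_kpath.
    - by rewrite st muln1 leqnn.
    - by move=> x /mem_take /dF.
    - by move=> x /dU'; rewrite inE => /andP[].
    by split=> x; [move/mem_take | move/mem_lastk]; move/dU'; rewrite inE => /andP[].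
  move=> hU; have [h|h] := leqP (t * j.+1) #|U :&: S j|.
    have [Q [[uQ kQ /andP[s1 s2] QF QS] QW]] := IH U (ltnW jq) h.
    exists Q; split=> //; split=> //; last by move=> x /QS; apply/subsetP.
    by rewrite s1 (leq_trans s2) // leq_mul.
  have : t <= #|U :&: (S j.+1 :\: S j)|.
    have : #|U :&: S j.+1| <= #|U :&: S j| + #|U :&: (S j.+1 :\: S j)|.
      rewrite -(cardsID (S j)); apply: leq_add.
        by apply/subset_leq_card; rewrite setSI ?subsetIl.
      by rewrite setIDA.
    by move: h hU; rewrite !mulnS; lia.
  case/big=> d [sd pd dU dF].
  have dS y : y \in d -> n <= q * #|[set x in S j | e x y]|.
    by move/dU; rewrite !inE; case: (y \in S j) => //= /andP[_].
  have [u [su ud hu]] := pick V e (S j) d n0 (leq_trans (leq_addr _ _) (eq_leq (esym sd))) dS.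
  have [|Q [[uQ kQ /andP[s1 s2] QF QS] [QW Qu]]] := IH (dominators e (S j) u) (ltnW jq).
    rewrite (setIidPl _); last by apply/subsetP => x; rewrite inE => /andP[].
    have g1 : 0 < g by rewrite /g addn_gt0 q0 orbT.
    rewrite -(leq_pmul2l g1); apply: leq_trans (_ : c * t <= _).
      by rewrite /c; nia.
    apply: leq_trans ct (leq_trans hu _); by rewrite leq_mul // leq_addr.
  have uU x : x \in u -> x \in U :&: (S j.+1 :\: S j) by move/(mem_subseq ud)/dU.
  exists (Q ++ u); split; first split.
  - rewrite cat_uniq uQ (uniqp u) ?(subseq_pairwise ud) // andbT /=.
    apply/hasPn => x /uU; rewrite !inE => /and3P[_ xS _].
    by apply: contra xS => /QS.
  - apply: kpath_cat => //; first by apply/pairwise_kpath/(subseq_pairwise ud).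
    apply/allrelP => x y /Qu; rewrite inE => /andP[_ /allP h1] /mem_take; exact: h1.
  - by rewrite size_cat su !mulnS; rewrite mulnS in s2; lia.
  - by move=> x; rewrite mem_cat => /orP[/QF//|/(mem_subseq ud)/dF].
  - move=> x; rewrite mem_cat => /orP[/QS|/uU]; first by apply/subsetP.
    by rewrite !inE => /and3P[].
  split; first by rewrite take_cat_leq.
  rewrite lastk_cat ?su // lastk_id ?su // => x /uU; by rewrite inE => /andP[].
have [|Q [[uQ kQ /andP[s1 s2] QF _] QW]] := key i W' (ltnW iq).
  rewrite -(leq_pmul2l q0); apply: leq_trans hW'; apply: leq_trans ct.
  rewrite /c /g; nia.
exists Q; split=> //; split=> //; rewrite s1 (leq_trans s2) // leq_mul // ltnS ltnW //.
Qed.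

(** * Dense connections under the degree condition *)

Lemma closed_count (V : finType) (e : rel V) (U : {set V}) m : tournament e ->
  (forall v, v \in U -> m <= 4 * outdeg e v) ->
  #|U| * m <= 2 * (#|U| * #|U|) + 4 * nedges e U (~: U).
Proof.
move=> tT hU; have := nedges_diag U tT.
suff : #|U| * m <= 4 * (nedges e U U + nedges e U (~: U)) by lia.
rewrite -nedges_disjoint_split; last by rewrite -setI_eq0 setICr.
rewrite nedges_card big_distrr /= -sum_nat_const; apply: leq_sum => v /hU h.
apply: leq_trans h _; rewrite leq_mul //; apply/subset_leq_card/subsetP => x.
by rewrite !inE => ->; case: (x \in U).
Qed.

(** The average out-degree inside [U] is below |U|/2, and it must be nearly n/4 because few edges
    leave [U]. The loss amounts to n/(2D) vertices. *)
Lemma closed_large (V : finType) (e : rel V) (U : {set V}) g D : tournament e -> 0 < #|V| ->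
  (forall v, #|V| <= 4 * outdeg e v) ->
  #|V| <= g * #|U| -> 4 * g * D * nedges e U (~: U) <= #|V| * #|V| ->
  D * #|V| <= 2 * D * #|U| + #|V|.
Proof.
move=> tT n0 hd hU hE; have := @closed_count _ e U _ tT (fun v _ => hd v).
move: hU hE; set n := #|V| in n0 *; set u := #|U|; set E := nedges _ _ _ => hU hE h.
have g0 : 0 < g by case: (g) hU => //; lia.
have u0 : 0 < u by case: (u) hU; lia.
have h1 : 4 * D * E <= n * u by rewrite -(leq_pmul2l g0); nia.
rewrite -(leq_pmul2l u0); nia.
Qed.

Lemma coclosed_large (V : finType) (e : rel V) (U : {set V}) g D : tournament e -> 0 < #|V| ->
  (forall v, #|V| <= 4 * indeg e v) ->
  #|V| <= g * #|U| -> 4 * g * D * nedges e (~: U) U <= #|V| * #|V| ->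
  D * #|V| <= 2 * D * #|U| + #|V|.
Proof.
move=> tT n0 hd hU hE.
by apply: (@closed_large _ (conv e) U g D (tournament_conv tT) n0 hd hU); rewrite nedges_conv.
Qed.

(* [A = B = setT] is the case where all sets of linear size are linked. *)
Lemma structure k g0 : 0 < g0 -> exists phi l n0, forall (V : finType) (e : rel V),
  tournament e -> n0 <= #|V| ->
  (forall v, #|V| <= 4 * outdeg e v) -> (forall v, #|V| <= 4 * indeg e v) ->
  exists A B : {set V},
    (forall W W' : {set V}, #|V| <= g0 * #|W| -> #|V| <= g0 * #|W'| ->
       #|V| <= 2 * g0 * #|W :&: A| \/ #|V| <= 2 * g0 * #|W' :&: B| ->
       linked e k phi l W W') /\
    ((A = setT /\ B = setT) \/
     [/\ B = ~: A, 64 * (64 * nedges e B A) <= #|V| * #|V|,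
         15 * #|V| <= 32 * #|A| & 15 * #|V| <= 32 * #|B|]).
Proof.
move=> g00; pose g := 2 * g0; pose D := 16 * g; pose q := 64 * (64 * (4 * (g * g))).
have g2 : 0 < g by rewrite muln_gt0.
have q0 : 0 < q by rewrite /q; nia.
have [phi [l [n0 hreach]]] := reach k q0.
exists phi, l, (n0 + 1) => V e tT hn hout hin.
set n := #|V| in hn hout hin *.
have n1 : 0 < n by move: hn; rewrite addn1; apply: leq_ltn_trans.
have {hn}hn : n0 <= n by rewrite (leq_trans _ hn) ?leq_addr.
have gq : 8 * g <= q by rewrite /q; nia.
have split_card (S T : {set V}) : #|S| = #|S :&: T| + #|S :&: ~: T|.
  by rewrite -setDE cardsID.
(* Either some almost closed set and its complement both have linear size, and they become the two
   halves, or every reached set [X] misses fewer than n/g vertices. *)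
have [/existsP[B /and3P[hB hA hE]]|] := boolP [exists B : {set V},
   [&& n <= g * #|B|, n <= g * #|~: B| & q * nedges e B (~: B) <= 2 * (n * n)]]; last first.
  rewrite negb_exists => /forallP none.
  exists setT, setT; split; last by left.
  move=> W W' hW hW' _; have [X [WX hE lk]] := hreach V e tT hn W.
  apply: lk; have := none X; rewrite hE andbT negb_and -!ltnNge => /orP[h|h].
    have := subset_leq_card WX; move: h hW; rewrite /g -/n; nia.
  have := split_card W' X; have := subset_leq_card (subsetIr W' (~: X)).
  move: h hW'; rewrite /g -/n => h hW' s1 s2.
  by apply: leq_trans (_ : 2 * g0 * #|W' :&: X| <= _); [nia | rewrite leq_mul //; nia].
exists (~: B), B.
have bigB : D * n <= 2 * D * #|B| + n.
  apply: (closed_large tT n1 hout hB); rewrite -/n.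
  by move: hE; rewrite /D /q; move: (nedges _ _ _) (n * n) => E nn; nia.
have bigA : D * n <= 2 * D * #|~: B| + n.
  apply: (coclosed_large tT n1 hin hA); rewrite -/n setCK.
  by move: hE; rewrite /D /q; move: (nedges _ _ _) (n * n) => E nn; nia.
split; last first.
  right; rewrite setCK; split=> //.
  - by move: hE; rewrite /q; move: (nedges _ _ _) (n * n) => E nn; nia.
  - by move: bigA; rewrite /D; move: (#|~: B|) => a; nia.
  - by move: bigB; rewrite /D; move: (#|B|) => a; nia.
have cAB : #|B| + #|~: B| = n by apply: cardsC.
(* Vertices of [~: B] missed by [X] receive few edges from outside; were they linearly many, they
   would number about n/2 and leave no room for [X :&: ~: B]. Vertices of [B] missed by [X] have few
   edges to and from [X :&: ~: B], so they are few as well. *)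
have step1 (W W' : {set V}) : n <= g * #|W :&: ~: B| -> n <= g0 * #|W'| -> linked e k phi l W W'.
  move=> hWA hW'; have [X [WX hX lk]] := hreach V e tT hn W; apply: lk.
  rewrite -/n in hX *; set EX := nedges e X (~: X) in hX; set EB := nedges e B (~: B) in hE.
  have hXA : n <= g * #|X :&: ~: B|.
    by apply: leq_trans hWA _; rewrite leq_mul // subset_leq_card // setSI.
  set U := ~: X :&: ~: B; set U' := ~: X :&: B.
  have cU : #|~: X| = #|U'| + #|U| by apply: split_card.
  have cA : #|~: B| = #|X :&: ~: B| + #|U|.
    by rewrite (split_card (~: B) X) setIC /U [in RHS](setIC (~: X)).
  have hU : 8 * g * #|U| < n.
    rewrite ltnNge; apply/negP => hU.
    have : D * n <= 2 * D * #|U| + n.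
      apply: (coclosed_large tT n1 hin hU); rewrite -/n.
      have : nedges e (~: U) U <= EX + EB.
        rewrite /U setCI !setCK; apply: leq_trans (nedgesUl _ _ _ _) _.
        by apply: leq_add; apply: nedgesS; rewrite // ?subsetIl ?subsetIr.
      move: hX hE; rewrite /D /q; move: EX EB (n * n) (nedges _ _ _) => x y nn z; nia.
    move: bigB cAB cA hXA; rewrite /D; move: (#|X :&: ~: B|) => z.
    by nia.
  have hU' : 64 * (64 * (g * #|U'|)) <= n.
    have h1 : q * (#|X :&: ~: B| * #|U'|) <= 4 * (n * n).
      rewrite -(nedges_both tT); last first.
        by rewrite -setI_eq0 /U' setIACA setICr set0I.
      have le1 : nedges e (X :&: ~: B) U' <= EX by apply: nedgesS; rewrite subsetIl.
      have le2 : nedges e U' (X :&: ~: B) <= EB by apply: nedgesS; rewrite subsetIr.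
      have := leq_trans (leq_mul (leqnn q) le1) hX.
      have := leq_trans (leq_mul (leqnn q) le2) hE.
      rewrite mulnDr; lia.
    have h2 : q * (n * #|U'|) <= g * (4 * (n * n)).
      by apply: leq_trans (leq_mul (leqnn g) h1); rewrite [leqRHS]mulnCA leq_mul // mulnA leq_mul.
    have gn : 0 < g * n by rewrite muln_gt0 g2.
    by rewrite -(leq_pmul2l gn); move: h2; rewrite /q; nia.
  have s1 := split_card W' X; have := subset_leq_card (subsetIr W' (~: X)).
  rewrite cU => s2; apply: leq_trans (_ : g * #|W' :&: X| <= _); last by rewrite leq_mul //; nia.
  have e1 := congr1 (muln g) s1; have := leq_mul (leqnn g) s2.
  move: hU hU' hW'; rewrite -mulnA !mulnDr in e1 *; rewrite {1}/g in e1; lia.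
move=> W W' hW hW' [hWA|hWB]; first exact: step1.
have [hWA|hWA] := leqP n (g * #|W :&: ~: B|); first exact: step1.
have hWB' : n <= g * #|W :&: B|.
  by have := split_card W B; move: hWA hW; rewrite /g; nia.
have [X [WX hX lk]] := hreach V e tT hn W; apply: lk.
rewrite -/n in hX *; set EX := nedges e X (~: X) in hX; set EB := nedges e B (~: B) in hE.
have hU : n <= g * #|X :&: B|.
  by apply: leq_trans hWB' _; rewrite leq_mul // subset_leq_card // setSI.
(* The intersection of two almost closed sets is almost closed, so [X] fills nearly all of [B]. *)
have bigU : D * n <= 2 * D * #|X :&: B| + n.
  apply: (closed_large tT n1 hout hU); rewrite -/n.
  have : nedges e (X :&: B) (~: (X :&: B)) <= EX + EB.
    rewrite setCI; apply: leq_trans (nedgesUr _ _ _ _) _.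
    by apply: leq_add; apply: nedgesS; rewrite // ?subsetIl ?subsetIr.
  by move: hX hE; rewrite /D /q; move: EX EB (n * n) (nedges _ _ _) => x y nn z; nia.
have cB := split_card B X; rewrite setIC in cB.
have s1 : #|W' :&: B| <= #|W' :&: X| + #|B :&: ~: X|.
  rewrite (split_card _ X) leq_add // subset_leq_card //.
    by rewrite setSI ?subsetIl.
  by rewrite setSI ?subsetIr.
apply: leq_trans (_ : 2 * g * #|W' :&: X| <= _); last by rewrite leq_mul //; nia.
have small : D * #|B :&: ~: X| <= n.
  have e1 := congr1 (muln D) cAB; have e2 := congr1 (muln D) cB.
  by rewrite mulnDr in e1; rewrite mulnDr in e2; clearbody D; lia.
have := leq_mul (leqnn g) s1; move: small hWB.
by rewrite -/g /D mulnDr -!mulnA; lia.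
Qed.

(** * Blocks and crossing edges *)

(* Head, interior and tail; vertices of the interior may be taken out later. *)
Definition piece (V : Type) : Type := seq V * seq V * seq V.
Definition phead (V : Type) (p : piece V) := p.1.1.
Definition pmid (V : Type) (p : piece V) := p.1.2.
Definition ptail (V : Type) (p : piece V) := p.2.
Definition pseq (V : Type) (p : piece V) := phead p ++ pmid p ++ ptail p.

Definition good_block (V : finType) (e : rel V) K L g (Sin Sout : {set V}) (p : piece V) : Prop :=
  [/\ size (phead p) = K, size (ptail p) = K & size (pmid p) = L] /\
  [/\ pairwise e (pseq p), #|V| <= g * #|dominators e Sin (phead p)| &
      #|V| <= g * #|dominators (conv e) Sout (ptail p)|].

(** Blocks are removed greedily: the first and last [N] vertices of a long transitive sequence are
    thinned to [K] by [pick_common]. The constant [g] is fixed before [L], because [L] is later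
    chosen from constants that depend on [g]. *)
Lemma good_blocks K q : 0 < K -> exists g, forall L, exists R0, forall (V : finType) (e : rel V)
    (Sin Sout U : {set V}), tournament e -> 0 < #|V| ->
  (forall u, u \in U -> #|V| <= q * #|[set x in Sin | e x u]|) ->
  (forall u, u \in U -> #|V| <= q * #|[set x in Sout | e u x]|) ->
  exists bs : seq (piece V),
    [/\ forall p, p \in bs -> good_block e K L g Sin Sout p,
        uniq (flatten (map (@pseq V) bs)), {subset flatten (map (@pseq V) bs) <= U} &
        #|[set x in U | x \notin flatten (map (@pseq V) bs)]| < R0].
Proof.
move=> K0; have [N [g pick]] := pick_common K q; exists g => L; exists (4 ^ (N + L + N)).
move=> V e Sin Sout U tT n0 hin hout.
have one (W : {set V}) : W \subset U -> 4 ^ (N + L + N) <= #|W| -> exists p : piece V,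
    good_block e K L g Sin Sout p /\ {subset pseq p <= W}.
  move=> /subsetP WU hW; have [t [st pt tW]] := transitive_seq tT hW.
  pose t1 := take N t; pose t2 := take L (drop N t); pose t3 := drop (N + L) t.
  have et : t = t1 ++ t2 ++ t3 by rewrite /t1 /t2 /t3 addnC -drop_drop !cat_take_drop.
  have s1 : size t1 = N by rewrite size_takel // st -addnA leq_addr.
  have s2 : size t2 = L by rewrite size_takel // size_drop st; lia.
  have s3 : size t3 = N by rewrite size_drop st; lia.
  have [f [sf ft hf]] := pick V e Sin t1 n0 (eq_leq (esym s1))
    (fun y h => hin y (WU _ (tW _ (mem_take h)))).
  have [b [sb bt hb]] := pick V (conv e) Sout t3 n0 (eq_leq (esym s3))
    (fun y h => hout y (WU _ (tW _ (mem_drop h)))).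
  have sub : subseq (f ++ t2 ++ b) t by rewrite et !cat_subseq.
  exists (f, t2, b); split; last by move=> x /(mem_subseq sub)/tW.
  by split; split=> //; apply: subseq_pairwise pt.
move: {2}(#|U|) (leqnn #|U|) => m; elim: m U hin hout one => [|m IH] U hin hout one hU.
  exists [::]; split=> //=; apply: leq_ltn_trans (_ : 0 < _); last by rewrite expn_gt0.
  by rewrite (leq_trans _ hU) // subset_leq_card //; apply/subsetP => x; rewrite inE => /andP[].
have [big|small] := leqP (4 ^ (N + L + N)) #|U|; last first.
  exists [::]; split=> //=; apply: leq_ltn_trans small.
  by rewrite subset_leq_card //; apply/subsetP => x; rewrite inE => /andP[].
have [p [gp pU]] := one U (subxx _) big.
have up : uniq (pseq p).
  by have [pp _ _] := gp.2; move: pp; apply: pairwise_uniq; case: tT.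
pose U' := [set x in U | x \notin pseq p].
have U'U : {subset U' <= U} by move=> x; rewrite inE => /andP[].
have [||||bs [gbs ubs bsU hbs]] := IH U'.
- by move=> u /U'U/hin.
- by move=> u /U'U/hout.
- by move=> W WU'; apply: one; apply: subset_trans WU' _; apply/subsetP.
- rewrite -ltnS; apply: leq_trans hU; apply: proper_card; apply/properP; split.
    exact/subsetP.
  have [[sf _ _] _] := gp; case E: (phead p) sf => [|x f] sf; first by rewrite -sf in K0.
  have xp : x \in pseq p by rewrite /pseq E mem_head.
  by exists x; [apply: pU | rewrite inE xp andbF].
exists (p :: bs); split=> /=.
- by move=> p'; rewrite inE => /orP[/eqP->|/gbs].
- rewrite cat_uniq up ubs andbT /=; apply/hasPn => x /bsU; by rewrite inE => /andP[].
- by move=> x; rewrite mem_cat => /orP[/pU|/bsU/U'U].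
- apply: leq_ltn_trans hbs; apply/subset_leq_card/subsetP => x.
  by rewrite !inE mem_cat negb_or => /and3P[-> -> ->].
Qed.

(** Since 2|U| falls short of n by at least |Z|, the degree condition makes at least |U|(4s + |Z|)/4
    edges leave [U], and few of them end in [Z]. *)
Lemma cross_count (V : finType) (e : rel V) (U W Z : {set V}) s : tournament e ->
  (forall v, #|V| + 4 * s <= 4 * outdeg e v) ->
  ~: U = W :|: Z -> 26 * #|V| <= 64 * #|U| -> 2 * #|U| + #|Z| <= #|V| ->
  64 * nedges e U Z <= 2 * (#|V| * #|Z|) ->
  #|V| * (8 * s + #|Z|) <= 24 * nedges e U W.
Proof.
move=> tT hd hUc hU hUZ hE; have := closed_count tT (fun v (_ : v \in U) => hd v).
have := nedgesUr e U W Z; rewrite -hUc.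
move: hU hUZ hE; move: (#|V|) (#|U|) (#|Z|) (nedges e U Z) (nedges e U (~: U)) (nedges e U W).
move=> n b z E1 E E2 hU hUZ hE h1 h2.
have h3 : b * (4 * s + z) <= 4 * E by nia.
have h4 : 26 * (n * (4 * s + z)) <= 64 * (b * (4 * s + z)) by rewrite !mulnA leq_mul.
nia.
Qed.

(** Up to small errors [V1] is [A] and [V2] is [B]. As |V1| + |V2| + |Z| = n, one of 2|V2| + |Z| <=
    n and 2|V1| + |Z| <= n holds; accordingly the edges leaving [V2] or those entering [V1] are
    counted. *)
Lemma cross_edges (V : finType) (e : rel V) (A B V1 V2 Z : {set V}) s : tournament e ->
  (forall v, #|V| + 4 * s <= 4 * outdeg e v) -> (forall v, #|V| + 4 * s <= 4 * indeg e v) ->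
  128 <= #|V| ->
  B = ~: A -> 64 * (64 * nedges e B A) <= #|V| * #|V| ->
  15 * #|V| <= 32 * #|A| -> 15 * #|V| <= 32 * #|B| ->
  V1 = [set v | #|V| <= 64 * #|[set x in A | e v x]|] ->
  V2 = [set v | (v \notin V1) && (#|V| <= 64 * #|[set x in B | e x v]|)] ->
  Z = ~: (V1 :|: V2) ->
  #|V| * (8 * s + #|Z|) <= 24 * nedges e V2 V1.
Proof.
move=> tT hout hin n128 eB hBA hA hB eV1 eV2 eZ; set n := #|V| in hout hin n128 hBA hA hB eV1 eV2 *.
have n0 : 0 < n by apply: leq_trans n128.
have memV1 v : (v \in V1) = (n <= 64 * #|[set x in A | e v x]|) by rewrite eV1 inE.
have memV2 v : (v \in V2) = (v \notin V1) && (n <= 64 * #|[set x in B | e x v]|).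
  by rewrite eV2 inE.
have ZA v : v \in Z -> 64 * #|[set x in A | e v x]| < n.
  by rewrite eZ !inE negb_or memV1 -ltnNge => /andP[].
have ZB v : v \in Z -> 64 * #|[set x in B | e x v]| < n.
  by rewrite eZ in_setC in_setU negb_or memV2 => /andP[-> /=]; rewrite -ltnNge.
(* Each vertex of [V1 :&: B] sends at least n/64 of the at most (n/64)^2 edges from [B] to [A]. *)
have c1 : 64 * #|V1 :&: B| <= n.
  rewrite -(leq_pmul2l n0) mulnCA; apply: leq_trans hBA; rewrite leq_mul //.
  rewrite mulnC -sum_nat_const nedges_card big_distrr /=.
  rewrite [leqRHS](big_setID V1) /= setIC; apply: leq_trans (leq_addr _ _).
  by apply: leq_sum => v; rewrite inE memV1 => /andP[].
have c2 : 64 * #|V2 :&: A| <= n.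
  rewrite -(leq_pmul2l n0) mulnCA; apply: leq_trans hBA; rewrite leq_mul //.
  rewrite mulnC -sum_nat_const nedges_card_r big_distrr /=.
  rewrite [leqRHS](big_setID V2) /= setIC; apply: leq_trans (leq_addr _ _).
  by apply: leq_sum => v; rewrite inE memV2 => /and3P[].
(* Vertices of [Z :&: B] have few in-neighbours inside [B], so [card_low_indegree] bounds their
   number. *)
have c3 : 32 * #|Z :&: B| <= n + 64.
  have : #|Z :&: B| <= 2 * (n %/ 64).+1.
    apply: leq_trans (card_low_indegree B (n %/ 64).+1 tT).
    apply/subset_leq_card/subsetP => v; rewrite !inE => /andP[/ZB h ->] /=.
    by move: h; move: (#|_|) => x; lia.
  by move: (#|_|) => x; lia.
have c4 : 32 * #|Z :&: A| <= n + 64.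
  have : #|Z :&: A| <= 2 * (n %/ 64).+1.
    apply: leq_trans (card_low_indegree A (n %/ 64).+1 (tournament_conv tT)).
    apply/subset_leq_card/subsetP => v; rewrite !inE => /andP[/ZA h ->] /=.
    by move: h; rewrite /conv; move: (#|_|) => x; lia.
  by move: (#|_|) => x; lia.
have dis12 : [disjoint V1 & V2].
  by rewrite -setI_eq0; apply/eqP/setP => v; rewrite !inE memV2; case: (v \in V1).
have splitA : #|A| <= #|V1| + #|V2 :&: A| + #|Z :&: A|.
  apply: leq_trans (_ : #|V1 :|: (V2 :&: A) :|: (Z :&: A)| <= _).
    apply/subset_leq_card/subsetP => v; rewrite eZ !inE => ->; rewrite !andbT.
    by case: (v \in V1) => //=; case: (v \in V2).
  apply: leq_trans (leq_card_setU _ _) _; rewrite leq_add2r; exact: leq_card_setU.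
have splitB : #|B| <= #|V1 :&: B| + #|V2| + #|Z :&: B|.
  apply: leq_trans (_ : #|(V1 :&: B) :|: V2 :|: (Z :&: B)| <= _).
    apply/subset_leq_card/subsetP => v; rewrite eZ !inE => ->; rewrite !andbT.
    by case: (v \in V1) => //=; case: (v \in V2).
  apply: leq_trans (leq_card_setU _ _) _; rewrite leq_add2r; exact: leq_card_setU.
have tot : #|V1| + #|V2| + #|Z| = n.
  by rewrite -cardsUI (disjoint_setI0 dis12) cards0 addn0 eZ cardsC.
have cAB (W : {set V}) : #|W| = #|W :&: A| + #|W :&: B| by rewrite eB -setDE cardsID.
have eBZ : 64 * nedges e B Z <= n * #|Z|.
  rewrite nedges_card_r big_distrr /= mulnC -sum_nat_const.
  by apply: leq_sum => v /ZB /ltnW.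
have eZA : 64 * nedges e Z A <= n * #|Z|.
  rewrite nedges_card big_distrr /= mulnC -sum_nat_const.
  by apply: leq_sum => v /ZA /ltnW.
have [h|h] := leqP (2 * #|V2| + #|Z|) n.
  apply: (cross_count tT hout) => //.
  - by apply/setP => v; rewrite eZ !inE; case: (v \in V1) (disjointFr dis12 (x := v)) => [->|] //; case: (v \in V2).
  - by rewrite -/n; lia.
  have : nedges e V2 Z <= nedges e (V2 :&: A) Z + nedges e B Z.
    apply: leq_trans (nedgesUl _ _ _ _); apply: nedgesS => //; apply/subsetP => v vV.
    by rewrite eB !inE vV; case: (v \in A).
  have := nedges_leq_mul e (V2 :&: A) Z.
  have := leq_mul c2 (leqnn #|Z|); rewrite -/n; lia.
have h' : 2 * #|V1| + #|Z| <= n by lia.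
rewrite -nedges_conv; apply: (cross_count (tournament_conv tT) hin) => //.
- by apply/setP => v; rewrite eZ !inE; case: (v \in V1) (disjointFr dis12 (x := v)) => [->|] //; case: (v \in V2).
- by rewrite -/n; lia.
rewrite nedges_conv.
have : nedges e Z V1 <= nedges e Z (V1 :&: B) + nedges e Z A.
  apply: leq_trans (nedgesUr _ _ _ _); apply: nedgesS => //; apply/subsetP => v vV.
  by rewrite eB !inE vV; case: (v \in A).
have := nedges_leq_mul e Z (V1 :&: B).
have := leq_mul c1 (leqnn #|Z|); rewrite -/n; lia.
Qed.

(** * Gluing pieces into a cycle *)

(** Appending the first [k] vertices makes the cyclic condition linear: an index that wraps around
    falls into the appended copy. *)
Lemma kpath_hamilton (V : finType) (e : rel V) k (p : seq V) : k < size p ->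
  uniq p -> (forall x, x \in p) -> kpath e k (p ++ take k p) ->
  contains_hamilton_cycle_power k e.
Proof.
move=> kp up allp hp.
have sp : size p = #|V| by rewrite -(card_uniqP up); apply: eq_card => x; rewrite allp.
have [x0 _] : exists x0, x0 \in p by case: (p) kp => // x s _; exists x; rewrite mem_head.
exists (fun i : 'I_#|V| => nth x0 p i) => [i j /eqP|i j].
  by rewrite nth_uniq ?sp // => /eqP/val_inj.
case/existsP=> d /eqP ej; set n := #|V| in i j ej sp *.
have hi := ltn_ord i; have hd := ltn_ord d.
have pi : nth x0 p i = nth x0 (p ++ take k p) i by rewrite nth_cat sp hi.
have -> : nth x0 p j = nth x0 (p ++ take k p) (i + d.+1).
  rewrite nth_cat sp ej; case: ltnP => h; first by rewrite modn_small.
  have -> : i + d.+1 = (i + d.+1 - n) + n by lia.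
  rewrite modnDr addnK modn_small; last lia.
  by rewrite nth_take //; lia.
rewrite pi; apply: kpath_nth hp _ _ _; try lia.
by rewrite size_cat size_takel ?sp //; rewrite sp in kp; lia.
Qed.

Lemma kpath_catl (V : finType) (e : rel V) k (p q : seq V) : kpath e k (p ++ q) -> kpath e k p.
Proof.
elim: p => //= x p IH /andP[/allP h /IH ->]; rewrite andbT.
apply/allP => y yp; apply: h; rewrite take_cat; case: ltnP => // kp.
by rewrite mem_cat (mem_take yp).
Qed.

Section Assembly.
Context (V : finType) (e : rel V) (k : nat).
Implicit Types (p next : piece V) (ps : seq (piece V)) (qs : seq (seq V)).

(** A [k]-path whose last [k] vertices lie in [inN p] can be followed by [p]; dually for [outN]. *)
Definition inN p : {set V} := dominators e setT (take k (phead p)).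
Definition outN p : {set V} := dominators (conv e) setT (lastk k (ptail p)).

(** Connectors may take vertices from the interior, and what remains must still be a [k]-path. *)
Definition flexible p : Prop :=
  [/\ k <= size (phead p), k <= size (ptail p) &
      forall m, subseq m (pmid p) -> kpath e k (phead p ++ m ++ ptail p)].

(* [next] is the piece entered after the last one. *)
Fixpoint chain_linked phi l next ps : Prop :=
  if ps is p :: ps' then
    linked e k phi l (outN p) (inN (head next ps')) /\ chain_linked phi l next ps'
  else True.

Fixpoint glued next ps qs : Prop :=
  match ps, qs with
  | p :: ps', Q :: qs' =>
      [/\ kpath e k Q, k <= size Q, {subset take k Q <= outN p} &
          {subset lastk k Q <= inN (head next ps')}] /\ glued next ps' qs'
  | [::], [::] => True
  | _, _ => False
  end.

(** [U] stands for the vertices used by the connectors. Lists of different lengths are excluded by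
    [glued]. *)
Fixpoint weave (U : seq V) ps qs : seq V :=
  match ps, qs with
  | p :: ps', Q :: qs' =>
      ((phead p ++ [seq x <- pmid p | x \notin U] ++ ptail p) ++ Q) ++ weave U ps' qs'
  | _, _ => [::]
  end.

Lemma connectors phi l next ps (F : {set V}) : chain_linked phi l next ps ->
  phi * (#|F| + l * size ps) <= #|V| ->
  exists qs, [/\ glued next ps qs, uniq (flatten qs) & forall x, x \in flatten qs -> x \notin F].
Proof.
elim: ps F => [|p ps IH] F /=; first by exists [::].
case=> lk ch hF; have [|Q [[uQ kQ /andP[s1 s2] QF] [QW QW']]] := lk F.
  by apply: leq_trans hF; rewrite leq_mul // leq_addr.
have [|qs [gl uqs qsF]] := IH (F :|: [set x in Q]) ch.
  apply: leq_trans hF; rewrite leq_mul // mulnS addnA leq_add2r.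
  apply: leq_trans (leq_card_setU _ _) _; rewrite leq_add2l.
  by rewrite cardsE (leq_trans (card_size _)).
exists (Q :: qs); split=> //=.
- by rewrite cat_uniq uQ uqs andbT /=; apply/hasPn => x /qsF; rewrite !inE negb_or => /andP[].
- move=> x; rewrite mem_cat => /orP[/QF //|/qsF]; by rewrite !inE negb_or => /andP[].
Qed.

Lemma take_weave U next ps qs : glued next ps qs -> (forall p, p \in ps -> flexible p) ->
  take k (weave U ps qs ++ take k (phead next)) = take k (phead (head next ps)).
Proof.
case: ps qs => [|p ps] [|Q qs] //= _ fl; first by rewrite take_takel.
have [h _ _] := fl p (mem_head _ _).
by rewrite -!catA take_cat_leq.
Qed.

Lemma kpath_weave U next ps qs : glued next ps qs -> (forall p, p \in ps -> flexible p) ->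
  kpath e k (take k (phead next)) -> kpath e k (weave U ps qs ++ take k (phead next)).
Proof.
move=> + + hnext; elim: ps qs => [|p ps IH] [|Q qs] //= [[kQ sQ QW QW'] gl] fl.
have fl' q : q \in ps -> flexible q by move=> qps; apply: fl; rewrite inE qps orbT.
have [h1 h2 h3] := fl p (mem_head _ _).
rewrite -catA; apply: kpath_cat; last first.
- rewrite lastk_cat // take_weave //; apply/allrelP => x y /QW'.
  by rewrite inE => /andP[_ /allP h] /h.
- exact: IH.
apply: kpath_cat => //; first by apply/h3/filter_subseq.
rewrite catA lastk_cat //; apply/allrelP => x y xt /QW.
by rewrite inE => /andP[_ /allP /(_ _ xt)].
Qed.

Lemma perm_weave U next ps qs : glued next ps qs ->
  perm_eq (weave U ps qs)
    (flatten [seq phead p ++ ptail p | p <- ps] ++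
     [seq x <- flatten (map (@pmid V) ps) | x \notin U] ++ flatten qs).
Proof.
elim: ps qs => [|p ps IH] [|Q qs] //= [_ gl].
have {IH} h := IH _ gl; rewrite filter_cat.
apply/permP => a; move/permP: h => /(_ a); rewrite !count_cat => ->.
by repeat move: (count a _) => ?; lia.
Qed.

(** Connectors are chosen to avoid all heads and tails. Since the pieces cover all vertices,
    connectors run through interiors only, where [weave] deletes their vertices and flexibility
    keeps the pieces intact. *)
Lemma assemble phi l (p : piece V) ps : tournament e -> 0 < k ->
  (forall q, q \in p :: ps -> flexible q) ->
  uniq (flatten (map (@pseq V) (p :: ps))) ->
  (forall x, x \in flatten (map (@pseq V) (p :: ps))) ->
  chain_linked phi l p (p :: ps) ->
  phi * (size (flatten [seq phead q ++ ptail q | q <- p :: ps]) + l * size (p :: ps)) <= #|V| ->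
  contains_hamilton_cycle_power k e.
Proof.
move=> tT k0 fl ups allps ch hphi.
set HT := flatten [seq phead q ++ ptail q | q <- p :: ps] in hphi.
set M := flatten (map (@pmid V) (p :: ps)).
have pHM : perm_eq (flatten (map (@pseq V) (p :: ps))) (HT ++ M).
  rewrite /HT /M; elim: (p :: ps) => //= q s IH.
  apply/permP => a; move/permP: IH => /(_ a); rewrite /pseq !count_cat => ->.
  by repeat move: (count a _) => ?; lia.
have uHM : uniq (HT ++ M) by rewrite -(perm_uniq pHM).
have inHM x : (x \in HT) || (x \in M) by rewrite -mem_cat -(perm_mem pHM).
have [|qs [gl uqs qsF]] := connectors (F := [set x in HT]) ch.
  apply: leq_trans hphi; rewrite leq_mul // leq_add2r cardsE; exact: card_size.
have {}qsF x : x \in flatten qs -> x \notin HT by move/qsF; rewrite inE.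
pose big := weave (flatten qs) (p :: ps) qs.
have pw := perm_weave (flatten qs) gl; rewrite -/big -/HT -/M in pw.
have [fp1 fp2 fp3] := fl p (mem_head _ _).
have tbig : take k big = take k (phead p).
  case: (qs) gl @big {pw} => [|Q qs'] //= _.
  by rewrite -!catA take_cat_leq.
apply: (@kpath_hamilton _ e k big).
- rewrite /big; case: (qs) gl => [|Q qs'] //= _; rewrite !size_cat; lia.
- rewrite (perm_uniq pw); clearbody M HT; move: uHM; rewrite !cat_uniq => /and3P[-> /hasPn h uM] /=.
  rewrite (filter_uniq (fun x => x \notin flatten qs) uM) uqs andbT /=; apply/andP; split.
    apply/hasPn => x; rewrite mem_cat mem_filter => /orP[/andP[_ /h]//|/qsF//].
  by apply/hasPn => x xq; rewrite /= mem_filter xq.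
- move=> x; clearbody M HT; rewrite (perm_mem pw) !mem_cat mem_filter.
  by move: (inHM x); case: (x \in HT); case: (x \in M); case: (x \in flatten qs).
- rewrite tbig; apply: kpath_weave => //.
  have := fp3 [::] (sub0seq _); rewrite -{1}(cat_take_drop k (phead p)) -catA.
  exact: kpath_catl.
Qed.
End Assembly.

(** * Short segments built from sparse edges *)

Lemma dominators_sub (V : finType) (e : rel V) (S S' : {set V}) (t t' : seq V) :
  S \subset S' -> {subset t' <= t} -> dominators e S t \subset dominators e S' t'.
Proof.
move=> /subsetP SS tt; apply/subsetP => x; rewrite !inE => /andP[/SS -> /allP h].
by apply/allP => y /tt /h.
Qed.

Definition segment_size k r := 2 * k + 2 * r + 3.

(** One statement for both uses: with [ow] empty the segment only passes from [X] to [Y], with [ow =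
    [:: w]] it also absorbs [w]. *)
Definition segment_supply (V : finType) (e : rel V) k r q g C : Prop :=
  forall (X Y Sin Sout : {set V}) (ow : seq V),
  [disjoint X & Y] ->
  C * #|V| ^ (2 * r + 1) <= nedges e X Y ^ r.+1 ->
  (forall u, u \in X -> #|V| <= q * #|[set x in Sin | e x u]|) ->
  (forall u, u \in Y -> #|V| <= q * #|[set x in Sout | e u x]|) ->
  size ow <= 1 ->
  (forall w, w \in ow -> (forall x, x \in X -> e x w) /\ (forall y, y \in Y -> e w y)) ->
  exists p : piece V,
    [/\ flexible e k p, uniq (pseq p) & size (pseq p) <= segment_size k r] /\
    [/\ {subset ow <= pseq p}, (forall x, x \in pseq p -> x \notin ow -> x \in X :|: Y),
        #|V| <= g * #|dominators e Sin (take k (phead p))| &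
        #|V| <= g * #|dominators (conv e) Sout (lastk k (ptail p))|].

(** The gadget supplies [N] extra vertices on either side, which [pick_common] thins to [k]. The
    middle [a ++ ow ++ b] has at least 2r + 2 >= k vertices, as [kpath_bridge] requires. *)
Lemma sparse_segment k r q : k <= 2 * r + 2 -> exists g C : nat,
  forall (V : finType) (e : rel V), tournament e -> 0 < #|V| -> segment_supply e k r q g C.
Proof.
move=> kr; have [N [g pick]] := pick_common k q; have [C gadget] := sparse_gadget r N.
exists g, C => V e tT n0 X Y Sin Sout ow dXY hC hX hY sow how.
have [da0 [a [b [db0 [[sa sb sda0 sdb0] [pda pdb da_X db_Y [da_b a_bdb]]]]]]] :=
  gadget V e X Y tT n0 hC.
have inX x : x \in da0 -> x \in X by move=> xd; apply: da_X; rewrite mem_cat xd.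
have inY x : x \in db0 -> x \in Y by move=> xd; apply: db_Y; rewrite mem_cat xd orbT.
have aX x : x \in a -> x \in X by move=> xd; apply: da_X; rewrite mem_cat xd orbT.
have bY x : x \in b -> x \in Y by move=> xd; apply: db_Y; rewrite mem_cat xd.
have [da [sda sub_da hda]] := pick V e Sin da0 n0 (eq_leq (esym sda0)) (fun y h => hX y (inX y h)).
have [db [sdb sub_db hdb]] := pick V (conv e) Sout db0 n0 (eq_leq (esym sdb0))
  (fun y h => hY y (inY y h)).
have daX x : x \in da -> x \in X by move/(mem_subseq sub_da)/inX.
have dbY x : x \in db -> x \in Y by move/(mem_subseq sub_db)/inY.
have irr : irreflexive e by case: tT.
have {pda}pda : pairwise e (da ++ a) by apply: subseq_pairwise pda; apply: cat_subseq.
have {pdb}pdb : pairwise e (b ++ db) by apply: subseq_pairwise pdb; apply: cat_subseq.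
have powb : pairwise e (ow ++ b ++ db).
  rewrite pairwise_cat pdb andbT; apply/andP; split.
    apply/allrelP => w y /how[_ h]; rewrite mem_cat => /orP[/bY|/dbY]; exact: h.
  by case: (ow) sow => [|w []].
have pall : pairwise e ((a ++ ow ++ b) ++ db).
  rewrite -!catA pairwise_cat powb andbT; move: pda; rewrite pairwise_cat => /and3P[_ _ ->].
  rewrite andbT; apply/allrelP => x y xa; rewrite mem_cat => /orP[/how[h _]|ybdb].
    by apply: h; apply: aX.
  apply: (allrelP a_bdb) => //; move: ybdb; rewrite !mem_cat => /orP[->//|].
  by move/(mem_subseq sub_db) ->; rewrite orbT.
have pda' : pairwise e da by move: pda; rewrite pairwise_cat => /and3P[].
have da_c : allrel e da (a ++ ow ++ b).
  apply/allrelP => x y xd; rewrite !mem_cat => /or3P[ya|yw|yb].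
  - by move: pda; rewrite pairwise_cat => /and3P[/allrelP h _ _]; apply: h.
  - by case: (how _ yw) => h _; apply: h; apply: daX.
  - by apply: (allrelP da_b) => //; apply: (mem_subseq sub_da).
(* The interior is empty, so that no connector passes through a segment. *)
pose p : piece V := (da ++ a ++ ow, [::], b ++ db).
have ep : pseq p = da ++ (a ++ ow ++ b) ++ db by rewrite /pseq /p /= -!catA.
exists p; split; split.
- split; rewrite ?size_cat ?sda ?sdb ?leq_addr ?leq_addl // => m; rewrite subseq0 => /eqP->.
  have := kpath_bridge (k := k) _ pda' pall da_c; rewrite -!catA; apply.
  by rewrite !size_cat sa sb; move: kr; clear; lia.
- have -> : pseq p = (da ++ a) ++ (ow ++ b ++ db) by rewrite ep -!catA.
  rewrite cat_uniq (pairwise_uniq irr pda) (pairwise_uniq irr powb) andbT /=.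
  have XY x : x \in X -> x \in Y -> False by move=> xX; rewrite (disjointFr dXY xX).
  have daaX x : x \in da ++ a -> x \in X by rewrite mem_cat => /orP[/daX|/aX].
  apply/hasPn => x xr; apply/negP => /daaX xX; move: xr; rewrite !mem_cat.
  case/or3P=> [xow|/bY|/dbY]; try exact: XY.
  by case: (how _ xow) => /(_ _ xX); rewrite irr.
- by rewrite ep !size_cat sda sdb sa sb /segment_size; move: sow; clear; lia.
- by move=> w wow; rewrite ep !mem_cat wow !orbT.
- move=> x; rewrite ep !mem_cat => xp /negbTE xow; move: xp; rewrite xow orFb inE.
  by case/or3P=> [/daX->//|/orP[/aX->//|/bY->]|/dbY->]; rewrite orbT.
- by rewrite take_cat_leq ?take_oversize ?sda.
- by rewrite lastk_cat ?sdb // lastk_id ?sdb.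
Qed.

(** * Segments kept apart at the block ends *)

Lemma mem_flatten_eq (T : eqType) (Es : seq (seq T)) E E' x :
  uniq (flatten Es) -> E \in Es -> E' \in Es -> x \in E -> x \in E' -> E = E'.
Proof.
elim: Es => //= F Es IH; rewrite cat_uniq => /and3P[_ /hasPn dis uEs].
have no G : G \in Es -> x \in G -> x \in F -> False.
  by move=> GE xG xF; have /dis/negP : x \in flatten Es by apply/flattenP; exists G.
rewrite !inE => /orP[/eqP->|hE] /orP[/eqP->|hE'] // xE xE'.
- by case: (no _ hE' xE' xE).
- by case: (no _ hE xE xE').
- exact: IH.
Qed.

Section Separate.
Context (V : finType).
Implicit Types (R F : {set V}) (Es : seq (seq V)) (p : piece V).

(** [Es] lists the heads and tails of the blocks: using [x] blocks the whole end containing it.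
    Including [x] itself makes segments disjoint outside [R]. *)
Definition endset Es (x : V) : {set V} :=
  [set y | (y == x) || has (fun E : seq V => (x \in E) && (y \in E)) Es].

Lemma card_endset Es K x : uniq (flatten Es) -> (forall E, E \in Es -> size E <= K) ->
  #|endset Es x| <= K.+1.
Proof.
move=> uEs hK; have [/hasP[E0 hE0 xE0]|/hasPn none] := boolP (has (fun E : seq V => x \in E) Es).
  apply: (@leq_trans #|x |: [set y in E0]|); last first.
    by rewrite cardsU1 cardsE -add1n leq_add ?leq_b1 // (leq_trans (card_size _)) ?hK.
  apply/subset_leq_card/subsetP => y; rewrite !inE => /orP[->//|/hasP[E hE /andP[xE yE]]].
  by rewrite (mem_flatten_eq uEs hE0 hE xE0 xE) yE orbT.
apply: (@leq_trans #|[set x]|); last by rewrite cards1.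
apply/subset_leq_card/subsetP => y; rewrite !inE => /orP[//|/hasP[E /none/negbTE->]].
by [].
Qed.

(* A segment avoids every block end met by an earlier one, so an end meets at most one segment. *)
Definition sep (g : V -> {set V}) R p p' : bool :=
  all (fun x => all (fun y => (y \in R) || (y \notin g x)) (pseq p')) (pseq p).

(** Greedy choice, [F] being the union of [g x] over the vertices of the earlier segments. The bound
    on [F] depends on the position in [ts], so the order of the tasks matters. *)
Lemma segments_exist (T : eqType) (P : T -> piece V -> Prop) (g : V -> {set V}) c kap R ts :
  (forall x, #|g x| <= c) ->
  (forall ts1 t ts2, ts = ts1 ++ t :: ts2 -> forall F, #|F| <= kap * size ts1 * c ->
     exists p, [/\ P t p, size (pseq p) <= kap & forall x, x \in pseq p -> x \in F -> x \in R]) ->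
  exists tps : seq (T * piece V),
    [/\ map fst tps = ts,
        forall tp, tp \in tps -> P tp.1 tp.2 /\ size (pseq tp.2) <= kap &
        pairwise (sep g R) (map snd tps)].
Proof.
move=> hg; elim/last_ind: ts => [|ts t IH] hts; first by exists [::].
have [|tps [ets hP hsep]] := IH.
  move=> ts1 t' ts2 ets F; apply: (hts ts1 t' (rcons ts2 t)).
  by rewrite ets rcons_cat rcons_cons.
pose S := flatten (map (@pseq V) (map snd tps)).
have sS : size S <= kap * size ts.
  rewrite -ets size_map /S; elim: (tps) hP => [|tp s IHs] hP //=.
  rewrite size_cat mulnS leq_add //; first by case: (hP tp (mem_head _ _)).
  by apply: IHs => q qs; apply: hP; rewrite inE qs orbT.
have [|p [Pp sp hp]] := hts ts t [::] (esym (cats1 _ _)) (\bigcup_(x in [set x in S]) g x).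
  apply: leq_trans (leq_card_bigcup _ _) _.
  apply: leq_trans (_ : \sum_(x in [set x in S]) c <= _); first exact: leq_sum.
  by rewrite sum_nat_const leq_mul // cardsE (leq_trans (card_size _)).
exists (rcons tps (t, p)); split.
- by rewrite map_rcons ets.
- by move=> tp; rewrite mem_rcons inE => /orP[/eqP->|/hP].
rewrite map_rcons -cats1 pairwise_cat hsep /= !andbT allrel1r.
apply/allP => q qs; apply/allP => x xq; apply/allP => y yp.
have [//|yR /=] := boolP (y \in R); apply: contra yR => yg.
apply: hp => //; apply/bigcupP; exists x => //; rewrite inE.
by apply/flattenP; exists (pseq q) => //; apply: map_f.
Qed.

(** The first segment meeting [E] bars all later ones from it, so every touched vertex of [E] lies
    in that one segment. *)
Lemma size_touched_end Es R E kap (ps : seq (piece V)) : E \in Es -> uniq E ->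
  (forall x, x \in E -> x \notin R) ->
  pairwise (sep (endset Es) R) ps -> (forall p, p \in ps -> size (pseq p) <= kap) ->
  size [seq x <- E | x \in flatten (map (@pseq V) ps)] <= kap.
Proof.
move=> hE uE hR; elim: ps => [|p ps IH] /=.
  by rewrite (eq_filter (a2 := pred0)) ?filter_pred0 // => x; rewrite in_nil.
case/andP=> /allP hp hps hk.
have [/hasP[x xE xp]|/hasPn none] := boolP (has (mem (pseq p)) E).
  apply: leq_trans (hk p (mem_head _ _)); apply: uniq_leq_size; first exact: filter_uniq.
  move=> y; rewrite mem_filter mem_cat => /andP[/orP[//|/flattenP[s /mapP[q qps ->] yq]] yE].
  have /allP/(_ y yq) := allP (hp q qps) x xp.
  rewrite (negbTE (hR y yE)) inE negb_or /= => /andP[_ /hasPn/(_ E hE)].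
  by rewrite xE yE.
rewrite (eq_in_filter (a2 := [in flatten (map (@pseq V) ps)])).
  by apply: IH => // q qps; apply: hk; rewrite inE qps orbT.
move=> x /none; rewrite -[mem _ x]/(x \in pseq p) => /negbTE xp.
by rewrite /= (mem_cat x (pseq p)) xp.
Qed.

(** As [x] lies in [g x], two segments can share only a vertex of [R]. It would be the tag of both,
    but tags other than [None] are distinct. *)
Lemma uniq_segments (g : V -> {set V}) R (tps : seq (option V * piece V)) :
  (forall x, x \in g x) ->
  (forall tp, tp \in tps -> uniq (pseq tp.2)) ->
  (forall tp x, tp \in tps -> x \in pseq tp.2 -> x \in R -> tp.1 = Some x) ->
  pairwise (fun t t' => (t == None) || (t != t')) (map fst tps) ->
  pairwise (sep g R) (map snd tps) ->
  uniq (flatten (map (@pseq V) (map snd tps))).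
Proof.
move=> hg; elim: tps => //= -[t p] tps IH hu htag /andP[/allP ht pt] /andP[/allP hs ps].
rewrite cat_uniq (hu _ (mem_head _ _)) IH //=; last 2 first.
- by move=> tp h; apply: hu; rewrite inE h orbT.
- by move=> tp x h; apply: htag; rewrite inE h orbT.
rewrite andbT; apply/hasPn => x /flattenP[s /mapP[q /mapP[tp tptps ->] ->] xq].
apply/negP => /= xp.
have /allP/(_ x xq) := allP (hs _ (map_f snd tptps)) x xp.
rewrite hg orbF => xR.
have e1 := htag _ _ (mem_head _ _) xp xR.
have e2 : tp.1 = Some x by apply: htag xq xR; rewrite inE tptps orbT.
by have := ht _ (map_f fst tptps); rewrite e2 /= in e1 *; rewrite e1 eqxx.
Qed.

End Separate.

(** * Restricting blocks and ordering pieces *)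

Lemma nedges_setD (V : finType) (e : rel V) (X Y F : {set V}) :
  nedges e X Y <= nedges e (X :\: F) (Y :\: F) + 2 * (#|V| * #|F|).
Proof.
have h1 : nedges e X Y <= nedges e (X :\: F) Y + nedges e (X :&: F) Y.
  by rewrite -{1}(setID X F) setUC; apply: nedgesUl.
have h2 : nedges e (X :\: F) Y <= nedges e (X :\: F) (Y :\: F) + nedges e (X :\: F) (Y :&: F).
  by rewrite -{1}(setID Y F) setUC; apply: nedgesUr.
have h3 : nedges e (X :&: F) Y <= #|V| * #|F|.
  apply: leq_trans (nedges_leq_mul _ _ _) _; rewrite mulnC leq_mul ?max_card //.
  by rewrite subset_leq_card // subsetIr.
have h4 : nedges e (X :\: F) (Y :&: F) <= #|V| * #|F|.
  apply: leq_trans (nedges_leq_mul _ _ _) _; rewrite leq_mul ?max_card //.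
  by rewrite subset_leq_card // subsetIr.
lia.
Qed.

Lemma half_count (V : finType) (e : rel V) (U W : {set V}) w s : tournament e ->
  (forall v, #|V| + 4 * s <= 4 * outdeg e v) -> ~: U \subset W :|: [set w] ->
  2 * #|U| <= #|V| -> #|V| <= 4 * #|U| -> #|V| * s <= 4 * nedges e U W + 2 * #|V|.
Proof.
move=> tT hd hUc hU hU'; have := closed_count tT (fun v (_ : v \in U) => hd v).
have := leq_trans (nedgesS e (subxx U) hUc) (nedgesUr e U W [set w]).
have := nedges_leq_mul e U [set w]; rewrite cards1 muln1.
move: hU hU'; move: (#|V|) (#|U|) (nedges e U [set w]) (nedges e U (~: U)) (nedges e U W).
move=> n u a b c h1 h2 h3 h4 h5.
have h6 : u * (4 * s) <= 4 * c + 4 * u by nia.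
have : n * s <= u * (4 * s) by rewrite mulnCA mulnA leq_mul.
lia.
Qed.

(** One of the two neighbourhoods has at most n/2 vertices. Edges leaving [X] end in [Y] or at [w],
    and edges entering [Y] start in [X] or at [w], so [half_count] applies to the smaller set. *)
Lemma insertion_edges (V : finType) (e : rel V) (w : V) s : tournament e ->
  (forall v, #|V| + 4 * s <= 4 * outdeg e v) -> (forall v, #|V| + 4 * s <= 4 * indeg e v) ->
  #|V| * s <= 4 * nedges e [set x | e x w] [set y | e w y] + 2 * #|V|.
Proof.
move=> tT hout hin; set X := [set x | e x w]; set Y := [set y | e w y].
have XYw : ~: X \subset Y :|: [set w].
  apply/subsetP => x; rewrite !inE => nexw; have [_|xw] := eqVneq x w; first by rewrite orbT.
  by rewrite (tournament_total tT xw nexw).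
have YXw : ~: Y \subset X :|: [set w].
  apply/subsetP => x; rewrite !inE => newx; have [_|xw] := eqVneq x w; first by rewrite orbT.
  by rewrite (tournament_total tT _ newx) // eq_sym.
have hX : #|V| <= 4 * #|X| by apply: leq_trans (hin w); apply: leq_addr.
have hY : #|V| <= 4 * #|Y| by apply: leq_trans (hout w); apply: leq_addr.
have XY : #|X| + #|Y| <= #|V|.
  rewrite -cardsUI (_ : X :&: Y = set0) ?cards0 ?addn0 ?max_card //.
  apply/setP => x; rewrite !inE; apply/andP => -[h1 h2].
  by rewrite (tournament_asym tT h1) in h2.
have [h|h] := leqP (2 * #|X|) #|V|; first exact: half_count XYw h hX.
rewrite -nedges_conv; apply: half_count (tournament_conv tT) hin YXw _ hY.
by move: h XY; clear; lia.
Qed.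

Definition restrict (V : eqType) (S : seq V) (p : piece V) : piece V :=
  ([seq x <- phead p | x \notin S], [seq x <- pmid p | x \notin S],
   [seq x <- ptail p | x \notin S]).

Section Pieces.
Context (V : finType) (e : rel V) (k : nat).
Implicit Types (S : seq V) (p : piece V) (ps : seq (piece V)).
Implicit Types (Sin Sout : {set V}).

Lemma pseq_restrict S p : pseq (restrict S p) = [seq x <- pseq p | x \notin S].
Proof. by rewrite /pseq /restrict /= !filter_cat. Qed.

Lemma flatten_restrict S ps :
  flatten (map (@pseq V) (map (restrict S) ps)) =
  [seq x <- flatten (map (@pseq V) ps) | x \notin S].
Proof. by elim: ps => //= p ps IH; rewrite filter_cat -IH pseq_restrict. Qed.

Definition large_in g (Sin : {set V}) p := #|V| <= g * #|dominators e Sin (take k (phead p))|.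
Definition large_out g (Sout : {set V}) p :=
  #|V| <= g * #|dominators (conv e) Sout (lastk k (ptail p))|.

Lemma large_inS g g' Sin (Sin' : {set V}) p : g <= g' -> Sin \subset Sin' ->
  large_in g Sin p -> large_in g' Sin' p.
Proof.
move=> gg SS; rewrite /large_in => h; apply: leq_trans h _; rewrite leq_mul //.
exact/subset_leq_card/dominators_sub.
Qed.

Lemma large_outS g g' Sout (Sout' : {set V}) p : g <= g' -> Sout \subset Sout' ->
  large_out g Sout p -> large_out g' Sout' p.
Proof.
move=> gg SS; rewrite /large_out => h; apply: leq_trans h _; rewrite leq_mul //.
exact/subset_leq_card/dominators_sub.
Qed.

(** Heads and tails carry [kap] spare vertices, so [k] of them survive, and passing to fewer
    vertices does not shrink the common neighbourhoods. *)
Lemma restrict_good_block S p kap L g Sin Sout :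
  good_block e (k + kap) L g Sin Sout p ->
  size [seq x <- phead p | x \in S] <= kap -> size [seq x <- ptail p | x \in S] <= kap ->
  [/\ flexible e k (restrict S p), large_in g Sin (restrict S p) &
      large_out g Sout (restrict S p)].
Proof.
case=> -[sh st sm] [pp hin hout] hS tS.
have cnt (s : seq V) : size s = k + kap -> size [seq x <- s | x \in S] <= kap ->
    k <= size [seq x <- s | x \notin S].
  move=> ss; rewrite !size_filter; have := count_predC [in S] s; rewrite ss.
  have -> : count (predC [in S]) s = count (fun x => x \notin S) s by apply: eq_count.
  by move: (count _ _) (count _ _) => a b; clear; lia.
split.
- split; [exact: cnt | exact: cnt |] => m /= sub; apply: pairwise_kpath.
  apply: subseq_pairwise pp; apply: cat_subseq; first exact: filter_subseq.
  apply: cat_subseq; last exact: filter_subseq.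
  by apply: subseq_trans sub _; apply: filter_subseq.
- apply: leq_trans hin _; rewrite leq_mul //; apply/subset_leq_card/dominators_sub => //.
  by move=> x /mem_take; rewrite mem_filter => /andP[].
- apply: leq_trans hout _; rewrite leq_mul //; apply/subset_leq_card/dominators_sub => //.
  by move=> x /mem_lastk; rewrite mem_filter => /andP[].
Qed.

Lemma chain_linked_path phi l (good : rel (piece V)) next ps p :
  (forall q q', q \in p :: ps -> q' \in next :: ps -> good q q' ->
     linked e k phi l (outN e k q) (inN e k q')) ->
  path good p (rcons ps next) -> chain_linked e k phi l next (p :: ps).
Proof.
elim: ps p => [|q ps IH] p hg /=.
  by move=> /andP[h _]; split=> //; apply: hg; rewrite ?mem_head.
case/andP=> pq hp; split.
  by apply: hg => //; rewrite !inE ?eqxx ?orbT.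
apply: IH hp => q1 q2 h1 h2; apply: hg; first by rewrite inE h1 orbT.
by move: h2; rewrite !inE => /orP[->|->]; rewrite ?orbT.
Qed.

End Pieces.

(** * Cyclic order of the pieces *)

Fixpoint interleave (T : Type) (ns cs : seq T) : seq T :=
  match ns, cs with n :: ns', c :: cs' => [:: n, c & interleave ns' cs'] | _, _ => [::] end.

Lemma perm_interleave (T : eqType) (ns cs : seq T) : size ns = size cs ->
  perm_eq (interleave ns cs) (ns ++ cs).
Proof.
elim: ns cs => [|n ns IH] [|c cs] //= [/IH/permP h].
apply/permP => a; move: (h a); rewrite /= !count_cat /= => ->.
by repeat move: (count a _) => ?; clear; lia.
Qed.

Section Order.
Context (T : eqType) (A B : pred T).
Let good : rel T := fun p q => A p || B q.

Lemma path_all_source x s1 s2 : A x -> all A s1 -> (forall y, A y -> path good y s2) ->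
  path good x (s1 ++ s2).
Proof.
elim: s1 x => [|y s1 IH] x Ax /=; first by move=> _; apply.
by case/andP=> Ay As h; rewrite /good Ax /=; apply: IH.
Qed.

Lemma path_interleave x ns cs s : A x -> all A cs -> all B cs ->
  (forall y, A y -> path good y s) -> path good x (interleave ns cs ++ s).
Proof.
elim: ns cs x => [|n ns IH] [|c cs] x Ax //=; try by move=> _ _; apply.
case/andP=> Ac Acs /andP[Bc Bcs] h; rewrite /good Ax Bc orbT /=.
exact: IH.
Qed.

Lemma path_all_target x s : all B s -> path good x s.
Proof. by elim: s x => //= y s IH x /andP[By Bs]; rewrite /good By orbT IH. Qed.

Lemma cyclic_order L1 ns L2 cs : all A L1 -> all B L2 -> all A cs -> all B cs ->
  all A (L1 ++ ns ++ L2 ++ cs) \/ size cs = (size ns).+1 ->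
  exists ps, perm_eq ps (L1 ++ ns ++ L2 ++ cs) /\ cycle good ps.
Proof.
move=> A1 B2 Ac Bc [allA|sz].
  exists (L1 ++ ns ++ L2 ++ cs); split=> //.
  case: (_ ++ _) allA => //= x s /andP[Ax As]; rewrite -cats1.
  by apply: path_all_source => // y Ay; rewrite /= /good Ay.
case: cs Ac Bc sz => [|c cs] //= /andP[Ac Acs] /andP[Bc Bcs] [sz].
exists (c :: L1 ++ interleave ns cs ++ L2); split.
  apply/permP => a; have/permP/(_ a) := perm_interleave (esym sz).
  rewrite /= !count_cat /= => ->.
  by repeat move: (count a _) => ?; clear; lia.
rewrite /= -cats1 -!catA; apply: path_all_source => // y Ay.
apply: path_interleave => // z Az; apply: path_all_target.
by rewrite all_cat B2 /= Bc.
Qed.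
End Order.

(** * Combining blocks and segments *)

Definition ends (V : Type) (bs : seq (piece V)) : seq (seq V) :=
  map (@phead V) bs ++ map (@ptail V) bs.

Lemma perm_ends (V : eqType) (bs : seq (piece V)) :
  perm_eq (flatten (map (@pseq V) bs)) (flatten (ends bs) ++ flatten (map (@pmid V) bs)).
Proof.
elim: bs => //= p bs /permP IH; apply/permP => a; move: (IH a).
rewrite /ends /pseq /= !flatten_cat /= !count_cat => ->.
by repeat move: (count a _) => ?; clear; lia.
Qed.

Lemma size_flatten_map_leq (T S : eqType) (f : T -> seq S) (s : seq T) m :
  (forall x, x \in s -> size (f x) <= m) -> size (flatten (map f s)) <= m * size s.
Proof.
elim: s => //= x s IH h; rewrite size_cat mulnS leq_add ?h ?mem_head //.
by apply: IH => y ys; apply: h; rewrite inE ys orbT.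
Qed.

(* [t = Some w] tags the segment inserting the leftover vertex [w], and [t = None] a segment
   returning from [B] to [A]. *)
Definition good_segment (V : finType) (e : rel V) k kap g (A B R : {set V})
    (t : option V) (p : piece V) : Prop :=
  [/\ flexible e k p, uniq (pseq p), large_in e k g setT p & large_out e k g setT p] /\
  [/\ forall x, x \in pseq p -> x \in R -> t = Some x,
      forall w, t = Some w -> w \in pseq p,
      t = None -> large_in e k g B p /\ large_out e k g A p &
      size (pseq p) <= kap].

(** Segments together with the blocks stripped of segment vertices partition the vertex set.
    Insertion segments and the blocks [bsz] are the neutral elements of [cyclic_order], hence |R| +
    |bsz| + 1 returns. *)
Lemma hamilton_of_blocks_and_segments (V : finType) (e : rel V) k kap L g phi l K (A B R : {set V})
    (bs1 bs2 bsz : seq (piece V)) (tps : seq (option V * piece V)) :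
  tournament e -> 0 < k -> 0 < #|V| ->
  (forall W W' : {set V}, #|V| <= g * #|W| -> #|V| <= g * #|W'| ->
     #|V| <= 2 * g * #|W :&: A| \/ #|V| <= 2 * g * #|W' :&: B| -> linked e k phi l W W') ->
  (forall p, p \in bs1 -> good_block e (k + kap) L g setT A p) ->
  (forall p, p \in bs2 -> good_block e (k + kap) L g B setT p) ->
  (forall p, p \in bsz -> good_block e (k + kap) L g setT setT p) ->
  uniq (flatten (map (@pseq V) (bs1 ++ bs2 ++ bsz))) ->
  (forall x, (x \in R) = (x \notin flatten (map (@pseq V) (bs1 ++ bs2 ++ bsz)))) ->
  (forall tp, tp \in tps -> good_segment e k kap g A B R tp.1 tp.2) ->
  map fst tps = map some (enum R) ++ nseq K None ->
  pairwise (sep (endset (ends (bs1 ++ bs2 ++ bsz))) R) (map snd tps) ->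
  K = (#|R| + size bsz).+1 \/ A = setT ->
  phi * ((2 * (k + kap) + l) * (size (bs1 ++ bs2 ++ bsz) + #|R| + K)) <= #|V| ->
  contains_hamilton_cycle_power k e.
Proof.
move=> tT k0 n0 lk g1 g2 gz ubs hR htp etps hsep hK hphi.
set bs := bs1 ++ bs2 ++ bsz in ubs hR hsep hphi.
pose segs := map snd tps; pose S := flatten (map (@pseq V) segs).
have gs p : p \in segs -> exists t, (t, p) \in tps /\ good_segment e k kap g A B R t p.
  by case/mapP=> -[t q] h /= ->; exists t; split=> //; apply: htp h.
have gb p : p \in bs -> good_block e (k + kap) L g setT setT p.
  rewrite !mem_cat => /or3P[/g1|/g2|/gz //] -[h [pp hi ho]]; split=> //; split=> //.
    by apply: leq_trans ho _; rewrite leq_mul // subset_leq_card // dominators_sub ?subsetT.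
  by apply: leq_trans hi _; rewrite leq_mul // subset_leq_card // dominators_sub ?subsetT.
have uEs : uniq (flatten (ends bs)).
  by move: ubs; rewrite (perm_uniq (perm_ends bs)) cat_uniq => /andP[].
have endbs E x : E \in ends bs -> x \in E -> x \in flatten (map (@pseq V) bs).
  move=> hE xE; rewrite (perm_mem (perm_ends bs)) mem_cat; apply/orP; left.
  by apply/flattenP; exists E.
have uE E : E \in ends bs -> uniq E.
  move=> hE; move: uEs; case/splitPr: hE => s1 s2.
  by rewrite flatten_cat /= !cat_uniq => /and3P[_ _ /and3P[]].
have touched E : E \in ends bs -> size [seq x <- E | x \in S] <= kap.
  move=> hE; apply: (size_touched_end hE (uE E hE)) hsep _.
    by move=> x xE; rewrite hR negbK (endbs E).
  by move=> p /gs[t [_ [_ []]]].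
have heads p : p \in bs -> phead p \in ends bs by move=> h; rewrite mem_cat map_f.
have tails p : p \in bs -> ptail p \in ends bs by move=> h; rewrite mem_cat (map_f _ h) orbT.
have rb p Sin Sout : p \in bs -> good_block e (k + kap) L g Sin Sout p ->
    [/\ flexible e k (restrict S p), large_in e k g Sin (restrict S p) &
        large_out e k g Sout (restrict S p)].
  by move=> pbs gp; apply: restrict_good_block gp _ _; apply: touched; [apply: heads|apply: tails].
have uS : uniq S.
  apply: (uniq_segments (R := R) (g := endset (ends bs))) hsep.
  - by move=> x; rewrite inE eqxx.
  - by move=> tp /htp[[]].
  - by move=> tp x /htp[_ [h _ _ _]]; apply: h.
  rewrite etps pairwise_cat; apply/and3P; split.
  - by apply/allrelP => x y _ /nseqP[->]; case: x.
  - rewrite pairwise_map; have := enum_uniq R; rewrite uniq_pairwise.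
    by apply: sub_pairwise => x y; rewrite /= => xy; apply: contra xy => /eqP[->].
  - by elim: K {etps hK hphi} => //= K ->; rewrite andbT; apply/allP.
have RS x : x \in R -> x \in S.
  move=> xR; have : Some x \in map fst tps.
    by rewrite etps mem_cat map_f ?mem_enum.
  case/mapP=> -[t p] tps_p /= et; apply/flattenP; exists (pseq p).
    by apply: map_f; apply/mapP; exists (t, p).
  by have [_ [_ h _ _]] := htp _ tps_p; apply: h.
pose I := [seq tp.2 | tp <- tps & tp.1 != None].
pose Cs := [seq tp.2 | tp <- tps & ~~ (tp.1 != None)].
have perm_segs : perm_eq (I ++ Cs) segs.
  by rewrite -map_cat; apply: perm_map; apply/permPl/perm_filterC.
have cnt (a : pred (option V)) : count (fun tp => a tp.1) tps = count a (map fst tps).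
  by rewrite count_map.
have sI : size I = #|R|.
  rewrite size_map size_filter (cnt (fun t => t != None)) etps count_cat count_map.
  rewrite (eq_count (a2 := predT)) // count_predT -cardE count_nseq /= mul0n addn0 //.
have sC : size Cs = K.
  rewrite size_map size_filter (cnt (fun t => ~~ (t != None))) etps count_cat count_map.
  by rewrite (eq_count (a2 := pred0)) // count_pred0 count_nseq /= mul1n.
pose rs := map (restrict S).
pose Aout p := #|V| <= 2 * g * #|outN e k p :&: A|.
pose Bin p := #|V| <= 2 * g * #|inN e k p :&: B|.
have outE p : outN e k p :&: A = dominators (conv e) A (lastk k (ptail p)).
  by apply/setP => x; rewrite !inE /= andbC.
have inE' p : inN e k p :&: B = dominators e B (take k (phead p)).
  by apply/setP => x; rewrite !inE /= andbC.
have AoutP p : large_out e k g A p -> Aout p.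
  by rewrite /Aout outE => h; apply: leq_trans h _; rewrite leq_mul // leq_pmull.
have BinP p : large_in e k g B p -> Bin p.
  by rewrite /Bin inE' => h; apply: leq_trans h _; rewrite leq_mul // leq_pmull.
have CsP p : p \in Cs -> large_in e k g B p /\ large_out e k g A p.
  case/mapP=> -[t q]; rewrite mem_filter /= negbK => /andP[/eqP-> /htp[_ [_ _ h _]]] ->.
  exact: h.
pose P0 := rs bs1 ++ (I ++ rs bsz) ++ rs bs2 ++ Cs.
have perm0 : perm_eq P0 (rs bs ++ segs).
  rewrite /P0 /bs /rs !map_cat; apply/permP => a; move/permP: perm_segs => /(_ a).
  rewrite !count_cat => <-; by repeat move: (count a _) => ?; clear; lia.
have pieceP p : p \in P0 -> [/\ flexible e k p, large_in e k g setT p & large_out e k g setT p].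
  rewrite (perm_mem perm0) mem_cat => /orP[/mapP[q qbs ->]|/gs[t [_ [[fp _ hi ho] _]]]] //.
  exact: rb (gb q qbs).
have pieceS p : p \in P0 -> size (phead p ++ ptail p) <= 2 * (k + kap).
  rewrite (perm_mem perm0) mem_cat => /orP[/mapP[q qbs ->]|/gs[t [_ [_ [_ _ _ hs]]]]].
    have [[sh st _] _] := gb q qbs; rewrite /restrict /phead /ptail /=.
    by rewrite size_cat mul2n -addnn leq_add // size_filter (leq_trans (count_size _ _)) // ?sh ?st.
  apply: leq_trans (_ : kap <= _); last by clear; lia.
  by apply: leq_trans hs; rewrite /pseq !size_cat leq_add2l leq_addl.
have [|||||ps [perm_ps cyc_ps]] :=
    @cyclic_order _ Aout Bin (rs bs1) (I ++ rs bsz) (rs bs2) Cs.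
- apply/allP => _ /mapP[p pbs ->]; apply: AoutP.
  by have [] := rb p _ _ _ (g1 p pbs); rewrite // !mem_cat pbs.
- apply/allP => _ /mapP[p pbs ->]; apply: BinP.
  by have [] := rb p _ _ _ (g2 p pbs); rewrite // !mem_cat pbs orbT.
- by apply/allP => p /CsP[_ /AoutP].
- by apply/allP => p /CsP[/BinP].
- case: hK => hK; [right | left].
    by rewrite sC size_cat sI size_map.
  by apply/allP => p /pieceP[_ _ ho]; apply: AoutP; rewrite hK.
rewrite -/P0 in perm_ps.
have perm_all : perm_eq (flatten (map (@pseq V) ps))
    ([seq x <- flatten (map (@pseq V) bs) | x \notin S] ++ S).
  rewrite -flatten_restrict -flatten_cat -map_cat; apply: perm_flatten; apply: perm_map.
  exact: perm_trans perm_ps perm0.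
have inP0 p : p \in ps -> p \in P0 by rewrite (perm_mem perm_ps).
have all_ps x : x \in flatten (map (@pseq V) ps).
  rewrite (perm_mem perm_all) mem_cat mem_filter; have [//|xS /=] := boolP (x \in S).
  by rewrite orbF; apply: contraR xS; rewrite -hR => /RS.
have size_ps : size ps = size bs + #|R| + K.
  rewrite (perm_size perm_ps) /P0 /bs !size_cat sI sC /rs !size_map.
  by repeat move: (size _) => ?; clear; lia.
have [x0 _] : exists x0 : V, x0 \in V by apply/card_gt0P.
case: ps perm_ps cyc_ps perm_all inP0 all_ps size_ps => [|p ps] _ cyc_ps perm_all inP0 all_ps size_ps.
  by have := all_ps x0.
apply: (assemble (p := p) (ps := ps) (phi := phi) (l := l) tT k0) => //.
- by move=> q /inP0/pieceP[].
- rewrite (perm_uniq perm_all) cat_uniq uS andbT filter_uniq //=.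
  by apply/hasPn => x xS; rewrite /= mem_filter xS.
- apply: chain_linked_path cyc_ps => q q' hq hq' /orP gq.
  have [_ _ ho] := pieceP q (inP0 q hq); have [_ hi _] := pieceP q' (inP0 q' hq').
  by apply: lk.
apply: leq_trans hphi; rewrite leq_mul // -size_ps mulnDl leq_add //.
by apply: size_flatten_map_leq => q /inP0/pieceS.
Qed.

(** * Proof of the theorem *)

Lemma good_blockW (V : finType) (e : rel V) K L g g' (Sin Sout : {set V}) p : g <= g' ->
  good_block e K L g Sin Sout p -> good_block e K L g' Sin Sout p.
Proof.
move=> gg [h [pp hi ho]]; split=> //; split=> //.
  by apply: leq_trans hi _; rewrite leq_mul.
by apply: leq_trans ho _; rewrite leq_mul.
Qed.

Lemma segment_supplyW (V : finType) (e : rel V) k r q g g' C : g <= g' ->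
  segment_supply e k r q g C -> segment_supply e k r q g' C.
Proof.
move=> gg sup X Y Sin Sout ow dXY hC hX hY sow how.
have [p [h [h1 h2 hi ho]]] := sup X Y Sin Sout ow dXY hC hX hY sow how.
exists p; split=> //; split=> //.
  by apply: leq_trans hi _; rewrite leq_mul.
by apply: leq_trans ho _; rewrite leq_mul.
Qed.

(** Turns an edge count of order n s into the hypothesis of [segment_supply]. *)
Lemma scale_pow_leq c C n s E r : 0 < c -> c ^ r.+1 * C * n ^ r <= s ^ r.+1 ->
  n * s <= c * E -> C * n ^ (2 * r + 1) <= E ^ r.+1.
Proof.
move=> c0 h1 h2; have cp : 0 < c ^ r.+1 by rewrite expn_gt0 c0.
rewrite -(leq_pmul2l cp) -expnMn; apply: leq_trans (leq_expn2r r.+1 h2).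
rewrite expnMn (_ : 2 * r + 1 = r + r.+1); last by clear; lia.
by rewrite expnD !mulnA mulnC leq_mul.
Qed.

Lemma size_blocks (V : finType) (e : rel V) K L g (Sin Sout U : {set V}) (bs : seq (piece V)) :
  (forall p, p \in bs -> good_block e K L g Sin Sout p) ->
  uniq (flatten (map (@pseq V) bs)) -> {subset flatten (map (@pseq V) bs) <= U} ->
  size bs * L <= #|U|.
Proof.
move=> hb ub bU; apply: leq_trans (_ : size (flatten (map (@pseq V) bs)) <= _).
  elim: bs hb {ub bU} => //= p bs IH hb; rewrite size_cat mulSn leq_add //.
    have [[_ _ <-] _] := hb p (mem_head _ _).
    by rewrite /pseq !size_cat addnCA leq_addr.
  by apply: IH => q qbs; apply: hb; rewrite inE qbs orbT.
by rewrite -(card_uniqP ub); apply/subset_leq_card/subsetP.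
Qed.

(** * Insertion and return segments *)

Section Tasks.
Context (V : finType) (e : rel V) (k r : nat).
Let kap := segment_size k r.

Lemma insertion_task g C s (F R : {set V}) (w : V) A B :
  segment_supply e k r 64 g C ->
  tournament e ->
  (forall v, #|V| + 4 * s <= 4 * outdeg e v) -> (forall v, #|V| + 4 * s <= 4 * indeg e v) ->
  24 ^ r.+1 * C * #|V| ^ r <= s ^ r.+1 ->
  4 + 16 * (#|F| + #|R|) <= s -> w \in R ->
  exists p, [/\ good_segment e k kap g A B R (Some w) p, size (pseq p) <= kap &
    forall x, x \in pseq p -> x \in F -> x \in R].
Proof.
move=> seg tT hout hin hC hs wR.
set X := [set x | e x w]; set Y := [set y | e w y]; set F' := F :|: R.
have cF : #|F'| <= #|F| + #|R| by apply: leq_card_setU.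
have dXY : [disjoint X :\: F' & Y :\: F'].
  rewrite -setI_eq0; apply/eqP/setP => x; rewrite !inE.
  by case exw: (e x w); rewrite ?andbF //= (tournament_asym tT exw) !andbF.
(* Deleting [F'] loses at most 2n|F'| edges; by [hs] this and the term 2n use up at most half of n
   s. *)
have hE : #|V| * s <= 24 * nedges e (X :\: F') (Y :\: F').
  have := insertion_edges w tT hout hin; rewrite -/X -/Y; have := nedges_setD e X Y F'.
  have := leq_mul (leqnn #|V|) hs; have := leq_mul (leqnn #|V|) cF.
  move: (#|V|) (nedges _ _ _) (nedges _ _ _) (#|F'|) (#|F| + #|R|) => n a b f f'; clear.
  rewrite mulnDr; nia.
have [||||p [[fp up sp] [owp pX hi ho]]] :=
  seg (X :\: F') (Y :\: F') setT setT [:: w] dXY (scale_pow_leq (isT : 0 < 24) hC hE).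
- move=> u _; apply: leq_trans (_ : 4 * indeg e u <= _).
    by apply: leq_trans (hin u); apply: leq_addr.
  by rewrite leq_mul // subset_leq_card //; apply/subsetP => x; rewrite !inE.
- move=> u _; apply: leq_trans (_ : 4 * outdeg e u <= _).
    by apply: leq_trans (hout u); apply: leq_addr.
  by rewrite leq_mul // subset_leq_card //; apply/subsetP => x; rewrite !inE.
- by [].
- by move=> w'; rewrite inE => /eqP->; split=> x; rewrite !inE => /andP[].
have avoid x : x \in pseq p -> x \in F' -> x = w.
  move=> xp xF; apply/eqP; have [//|xw] := boolP (x == w).
  by have := pX x xp; rewrite mem_seq1 xw => /(_ isT); rewrite in_setU !in_setD xF.
exists p; split=> //; last first.
  by move=> x xp xF; rewrite (avoid x xp) // inE xF.
split; split=> //.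
- by move=> x xp xR; rewrite (avoid x xp) // inE xR orbT.
- by move=> _ [<-]; apply: owp; rewrite mem_head.
Qed.

(** A segment from [V2] to [V1] can be entered from [B] and left into [A], whichever half contains
    its own vertices. *)
Lemma crossing_task g C s (F R A B V1 V2 : {set V}) :
  segment_supply e k r 64 g C ->
  [disjoint V2 & V1] ->
  (forall v, v \in V1 -> #|V| <= 64 * #|[set x in A | e v x]|) ->
  (forall v, v \in V2 -> #|V| <= 64 * #|[set x in B | e x v]|) ->
  24 ^ r.+1 * C * #|V| ^ r <= s ^ r.+1 ->
  #|V| * s + 48 * (#|V| * (#|F| + #|R|)) <= 24 * nedges e V2 V1 ->
  exists p, [/\ good_segment e k kap g A B R None p, size (pseq p) <= kap &
    forall x, x \in pseq p -> x \in F -> x \in R].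
Proof.
move=> seg dV h1 h2 hC hE; set F' := F :|: R.
have cF : #|F'| <= #|F| + #|R| by apply: leq_card_setU.
have dXY : [disjoint V2 :\: F' & V1 :\: F'].
  by apply: disjointWl (subsetDl _ _) (disjointWr (subsetDl _ _) dV).
have hE' : #|V| * s <= 24 * nedges e (V2 :\: F') (V1 :\: F').
  move: hE; have := nedges_setD e V2 V1 F'; have := leq_mul (leqnn #|V|) cF.
  by move: (_ * s) (nedges _ _ _) (nedges _ _ _) (_ * #|F'|) (_ * (#|F| + _)) => n a b f f'; clear; lia.
have [||||p [[fp up sp] [owp pX hi ho]]] :=
  seg (V2 :\: F') (V1 :\: F') B A [::] dXY (scale_pow_leq (isT : 0 < 24) hC hE').
- by move=> u; rewrite inE => /andP[_ /h2].
- by move=> u; rewrite inE => /andP[_ /h1].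
- by [].
- by [].
have avoid x : x \in pseq p -> x \notin F'.
  move=> xp; apply/negP => xF; have := pX x xp isT.
  by rewrite in_setU !in_setD xF.
have noF x : x \in pseq p -> x \notin F /\ x \notin R.
  by move/avoid; rewrite inE negb_or => /andP[].
exists p; split=> //; last by move=> x /noF[/negP].
split; split=> //.
- exact: large_inS (leqnn g) (subsetT B) hi.
- exact: large_outS (leqnn g) (subsetT A) ho.
- by move=> x /noF[_ /negP].
Qed.

End Tasks.

(** The theorem over the natural numbers, [s] being the excess of the semidegrees over n/4. *)
Lemma hamilton_cycle_power_nat k r : 0 < k -> k <= 2 * r + 2 -> exists C : nat,
  forall (V : finType) (e : rel V) s, tournament e -> 0 < #|V| ->
  (forall v, #|V| + 4 * s <= 4 * outdeg e v) -> (forall v, #|V| + 4 * s <= 4 * indeg e v) ->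
  C * #|V| ^ r <= s ^ r.+1 -> contains_hamilton_cycle_power k e.
Proof.
move=> k0 kr; set kap := segment_size k r.
have K0 : 0 < k + kap by rewrite addn_gt0 k0.
have [gb hb] := good_blocks 64 K0.
have [gs [Csp hs]] := sparse_segment 64 kr.
pose g := gb + gs + 1; have g0 : 0 < g by rewrite /g addn1.
have [phi [l [n1 hstr]]] := structure k g0.
(* A segment has at most [kap] vertices, each in at most one end, so that it forbids at most
   [kap * c] vertices to the later ones; [48 * (kap * c) <= L] lets the edges counted by [Z]
   pay for the returns after the blocks inside [Z]. *)
pose Phi := phi * (2 * (k + kap) + l); pose c := (k + kap).+1.
pose L := 48 * (kap * c) + 4 * Phi.
have [R0 hR0] := hb L.
(* Fewer than [R0] vertices are left over in each of [V1], [V2] and [Z]. At most 2 rho + 1 + |bsz|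
   segments are built. *)
pose rho := 3 * R0; pose s0 := 48 * (kap * c * (2 * rho + 1) + rho) + 4.
exists (24 ^ r.+1 * Csp + s0 + n1 + 128 + 2 * (Phi * (2 * rho + 1))).
move=> V e s tT n0 hout hin hC.
have gbg : gb <= g by rewrite /g -addnA leq_addr.
have gsg : gs <= g by rewrite /g addnAC leq_addl.
have sn : s <= #|V|.
  have [v _] : exists v : V, v \in V by apply/card_gt0P.
  have od : outdeg e v <= #|V| by apply: max_card.
  by have := hout v; move: od; move: (outdeg e v) (#|V|) => d n; clear; lia.
have nr0 : 0 < #|V| ^ r by rewrite expn_gt0 n0.
(* As [s <= n], we have s^(r+1) <= s n^r; cancelling n^r shows that [s] exceeds every constant used
   below. *)
have Cs : 24 ^ r.+1 * Csp + s0 + n1 + 128 + 2 * (Phi * (2 * rho + 1)) <= s.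
  rewrite -(leq_pmul2r nr0); apply: leq_trans hC _.
  by rewrite expnS leq_mul // leq_expn2r.
have hC' : 24 ^ r.+1 * Csp * #|V| ^ r <= s ^ r.+1.
  apply: leq_trans hC; rewrite (leq_pmul2r nr0).
  by move: (_ * Csp) (s0) (2 * _) => a b d; clear; lia.
have [s0s n1n n128 Phin] : [/\ s0 <= s, n1 <= #|V|, 128 <= #|V| &
    2 * (Phi * (2 * rho + 1)) <= #|V|].
  by move: Cs sn; move: (_ * Csp) (s0) (2 * _) (#|V|) => a b d n; clear; split; lia.
have hout4 v : #|V| <= 4 * outdeg e v by apply: leq_trans (hout v); apply: leq_addr.
have hin4 v : #|V| <= 4 * indeg e v by apply: leq_trans (hin v); apply: leq_addr.
have [A [B [lk hAB]]] := hstr V e tT n1n hout4 hin4.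
have outT u : #|V| <= 64 * #|[set x in setT | e u x]|.
  apply: leq_trans (hout4 u) _; rewrite leq_mul // subset_leq_card //.
  by apply/subsetP => x; rewrite !inE.
have inT u : #|V| <= 64 * #|[set x in setT | e x u]|.
  apply: leq_trans (hin4 u) _; rewrite leq_mul // subset_leq_card //.
  by apply/subsetP => x; rewrite !inE.
pose V1 := [set v | #|V| <= 64 * #|[set x in A | e v x]|].
pose V2 := [set v | (v \notin V1) && (#|V| <= 64 * #|[set x in B | e x v]|)].
pose Z := ~: (V1 :|: V2).
have V1P u : u \in V1 -> #|V| <= 64 * #|[set x in A | e u x]| by rewrite inE.
have V2P u : u \in V2 -> #|V| <= 64 * #|[set x in B | e x u]| by rewrite [u \in V2]inE => /andP[].
have V12 u : u \in V2 -> u \notin V1 by rewrite [u \in V2]inE => /andP[].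
have ZP u : u \in Z -> (u \notin V1) && (u \notin V2) by rewrite [u \in Z]inE in_setU negb_or.
have [bs1 [gb1 ub1 bs1V hb1]] := hR0 V e setT A V1 tT n0 (fun u _ => inT u) V1P.
have [bs2 [gb2 ub2 bs2V hb2]] := hR0 V e B setT V2 tT n0 V2P (fun u _ => outT u).
have [bsz [gbz ubz bszV hbz]] := hR0 V e setT setT Z tT n0 (fun u _ => inT u) (fun u _ => outT u).
pose bs := bs1 ++ bs2 ++ bsz.
have ubs : uniq (flatten (map (@pseq V) bs)).
  rewrite !map_cat !flatten_cat !cat_uniq ub1 ub2 ubz andbT /=; apply/andP; split.
    apply/hasPn => x; rewrite mem_cat => xbs; apply/negP => /bs1V xV1.
    case/orP: xbs => [/bs2V/V12|/bszV/ZP/andP[]]; by rewrite xV1.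
  by apply/hasPn => x /bszV/ZP/andP[_]; apply: contra => /bs2V.
pose R := [set x | x \notin flatten (map (@pseq V) bs)].
have Rrho : #|R| <= rho.
  pose Ri (U : {set V}) b := [set x in U | x \notin flatten (map (@pseq V) b)].
  apply: leq_trans (_ : #|Ri V1 bs1 :|: Ri V2 bs2 :|: Ri Z bsz| <= _).
    apply/subset_leq_card/subsetP => x.
    rewrite inE !map_cat !flatten_cat !mem_cat !negb_or => /and3P[x1 x2 xz].
    rewrite !in_setU !(in_set (fun x => (x \in _) && _)) x1 x2 xz !andbT [x \in Z]inE in_setU.
    by case: (x \in V1); case: (x \in V2).
  apply: leq_trans (leq_card_setU _ _) _.
  have : [/\ #|Ri V1 bs1| < R0, #|Ri V2 bs2| < R0 & #|Ri Z bsz| < R0] by split.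
  have [h _] := leq_card_setU (Ri V1 bs1) (Ri V2 bs2); move: h; rewrite /rho.
  move: (#|Ri V1 _ :|: _|) (#|Ri V1 _|) (#|Ri V2 _|) (#|Ri Z _|) => f a b d.
  by clear => h [ha hb hd]; lia.
have zL : size bsz * L <= #|Z| by apply: size_blocks gbz ubz bszV.
have nL : size bs * L <= #|V|.
  apply: leq_trans (_ : #|V1| + (#|V2| + #|Z|) <= _).
    rewrite !size_cat !mulnDl leq_add ?(size_blocks gb1) // leq_add //.
    exact: size_blocks gb2 ub2 bs2V.
  rewrite -(cardsC (V1 :|: V2)) -/Z addnA leq_add2r.
  rewrite -cardsUI (_ : V1 :&: V2 = set0) ?cards0 ?addn0 //.
  apply/setP => x; rewrite in_setI in_set0; apply/andP => -[x1 /V12].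
  by rewrite x1.
(* If [A] is the whole vertex set, no connection is missing and no return is made. *)
pose K := if A == setT then 0 else (#|R| + size bsz).+1.
(* Insertions come first, so that their forbidden sets have at most [kap * c * rho] vertices, a
   bound free of the number of blocks in [Z]. *)
pose ts : seq (option V) := map some (enum R) ++ nseq K None.
have uEs : uniq (flatten (ends bs)).
  by move: ubs; rewrite (perm_uniq (perm_ends bs)) cat_uniq => /andP[].
have endsize E : E \in ends bs -> size E <= k + kap.
  rewrite mem_cat => /orP[] /mapP[p + ->].
  - by rewrite !mem_cat => /or3P[/gb1|/gb2|/gbz] [[-> _ _] _].
  - by rewrite !mem_cat => /or3P[/gb1|/gb2|/gbz] [[_ -> _] _].
have [|tps [etps tpsP hsep]] := @segments_exist V (option V) (good_segment e k kap g A B R)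
    (endset (ends bs)) c kap R ts (fun x => card_endset x uEs endsize).
  move=> ts1 t ts2 ets F hF.
  have et : nth None ts (size ts1) = t by rewrite ets nth_cat ltnn subnn.
  have sts : size ts1 < #|R| + K.
    have : size ts1 < size ts by rewrite ets size_cat /= addnS ltnS leq_addr.
    by rewrite size_cat size_map -cardE size_nseq.
  case: t ets et => [w|] ets et.
    have sw : size ts1 < #|R|.
      rewrite ltnNge; apply/negP => h; move: et.
      by rewrite nth_cat size_map -cardE ltnNge h /= nth_nseq; case: ifP.
    have wR : w \in R.
      have : Some w \in ts by rewrite ets mem_cat mem_head orbT.
      rewrite mem_cat => /orP[/mapP[w' + [->]]|/nseqP[]//]; by rewrite mem_enum.
    apply: (insertion_task (g := g) A B _ tT hout hin hC' _ wR).
      by apply: segment_supplyW (hs V e tT n0).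
    apply: leq_trans s0s; rewrite /s0.
    have hF' : #|F| <= kap * c * rho.
      apply: leq_trans hF _; rewrite mulnAC leq_mul //; exact: leq_trans (ltnW sw) Rrho.
    by move: hF' Rrho; move: (#|F|) (#|R|) (rho) (kap * c) => f x y z; clear; lia.
  have [AT|AT] := eqVneq A setT.
    have : None \in ts by rewrite ets mem_cat mem_head orbT.
    by rewrite /ts /K AT eqxx cats0 => /mapP[].
  case: hAB => [[A_T _]|[eB hBA hA hB]]; first by rewrite A_T eqxx in AT.
  apply: (crossing_task (g := g) (s := s) (V1 := V1) (V2 := V2) (C := Csp)) => //.
  - by apply: segment_supplyW (hs V e tT n0).
  - by rewrite -setI_eq0; apply/eqP/setP => x; rewrite in_setI in_set0; apply/andP => -[/V12/negP].
  have := cross_edges (V1 := V1) (V2 := V2) (Z := Z) tT hout hin n128 eB hBA hA hB erefl erefl erefl.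
  apply: leq_trans; rewrite mulnCA -mulnDr leq_mul //.
  have hF' : #|F| <= kap * c * (2 * rho) + kap * c * size bsz.
    apply: leq_trans hF _; rewrite mulnAC -mulnDr leq_mul //.
    by move: sts Rrho; rewrite /K (negbTE AT); move: (#|R|) (size bsz) => x y; clear; lia.
  have hz : 48 * (kap * c * size bsz) <= #|Z|.
    by apply: leq_trans zL; rewrite mulnA mulnC leq_mul // /L leq_addr.
  move: hF' hz Rrho s0s; rewrite /s0.
  by move: (#|F|) (#|R|) (#|Z|) (rho) (size bsz) (kap * c) => f x y z u v; clear; lia.
apply: (@hamilton_of_blocks_and_segments V e k kap L g phi l K A B R bs1 bs2 bsz tps) => //.
- by move=> p /gb1; apply: good_blockW.
- by move=> p /gb2; apply: good_blockW.
- by move=> p /gbz; apply: good_blockW.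
- by move=> x; rewrite inE.
- by move=> tp /tpsP[].
- by rewrite /K; case: eqP; [right | left].
rewrite mulnA -/Phi.
have K_le : size bs + #|R| + K <= 2 * size bs + (2 * rho + 1).
  have : size bsz <= size bs by rewrite /bs !size_cat; apply: leq_trans (leq_addl _ _) (leq_addl _ _).
  by move: Rrho; rewrite /K; case: ifP => _; move: (#|R|) (size bsz) (size bs) => x y z; clear; lia.
apply: leq_trans (leq_mul (leqnn Phi) K_le) _; rewrite mulnDr.
have : 4 * Phi * size bs <= #|V|.
  by apply: leq_trans nL; rewrite mulnC leq_mul // /L leq_addl.
rewrite -mulnA (mulnCA Phi); move: Phin.
by move: (Phi * size bs) (Phi * _) (#|V|) => x y z; clear; lia.
Qed.

(** * Passage to the real exponent *)

Import Order.TTheory GRing.Theory Num.Theory.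

Lemma min_semidegree_leq (V : finType) (e : rel V) v :
  min_semidegree e <= indeg e v /\ min_semidegree e <= outdeg e v.
Proof.
apply/andP; rewrite -leq_min /min_semidegree.
elim: (index_enum V) (mem_index_enum v) => //= x s IH.
rewrite inE big_cons => /orP[/eqP->|/IH h]; first exact: geq_minl.
by apply: leq_trans (geq_minr _ _) h.
Qed.

Local Open Scope ring_scope.

Theorem theorem1p2 (R : realType) (k : nat) (hk : (0 < k)%N) :
  exists2 c : R, 0 < c &
    forall (n : nat) (V : finType) (e : rel V),
      tournament e -> #|V| = n ->
      n%:R / 4 + c * n%:R `^ (1 - 1 / (uphalf k)%:R) <= (min_semidegree e)%:R ->
      contains_hamilton_cycle_power k e.
Proof.
case er : (uphalf k) => [|r]; first by lia.
have kr : (k <= 2 * r + 2)%N by lia.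
have [C hC] := hamilton_cycle_power_nat hk kr.
(* The factor 2 absorbs rounding: 4d - n >= 8(C+1)p gives s > 2(C+1)p - 1 >= (C+1)p, since p >=
   1. *)
exists (2 * C.+1%:R) => [|m V e tT <-]; first by rewrite mulr_gt0.
set n := #|V| => hd.
(* On the empty tournament the required copy is empty. *)
have [V0|n0] := posnP #|V|.
  by exists (fun i : 'I_#|V| => enum_val i) => [|x]; [exact: enum_val_inj | have := ltn_ord x; lia].
set p := n%:R `^ _ in hd; set d := min_semidegree e in hd.
have p0 : 0 <= p by apply: powR_ge0.
(* The exponent 1 - 1/(r+1) equals r/(r+1). *)
have pE : p ^+ r.+1 = n%:R ^+ r.
  rewrite -powR_mulrn // /p -powRrM -powR_mulrn ?ler0n //; congr (_ `^ _).
  by rewrite div1r mulrBl mul1r mulVf ?pnatr_eq0 // -natr1 addrK.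
have p1 : 1 <= p.
  by rewrite -(@expr_ge1 _ r.+1) // pE -natrX ler1n expn_gt0 n0.
pose s := ((4 * d - n) %/ 4)%N.
have hd4 : n%:R + 8 * C.+1%:R * p <= (4 * d)%:R :> R.
  rewrite natrM; have := hd; lra.
have nd : (n <= 4 * d)%N.
  by rewrite -(ler_nat R); apply: le_trans hd4; rewrite lerDl !mulr_ge0.
have [ns sn] : (n + 4 * s <= 4 * d)%N /\ (4 * d < n + 4 * s + 4)%N.
  by move: nd; rewrite /s; move: (n) (d) => a b; clear; lia.
have hs : C.+1%:R * p <= s%:R.
  have : (4 * d)%:R < n%:R + 4 * s%:R + 4 :> R by rewrite -natrM -!natrD ltr_nat.
  move: hd4.
  have : 1 <= C.+1%:R * p by rewrite -[leLHS]mulr1 ler_pM // ler1n.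
  lra.
apply: (hC V e s tT n0).
- by move=> v; apply: leq_trans ns _; rewrite leq_mul //; have [] := @min_semidegree_leq V e v.
- by move=> v; apply: leq_trans ns _; rewrite leq_mul //; have [] := @min_semidegree_leq V e v.
rewrite -(ler_nat R) natrM !natrX -/n -pE.
apply: (@le_trans _ _ ((C.+1%:R * p) ^+ r.+1)); last by apply: lerXn2r; rewrite ?nnegrE ?mulr_ge0.
rewrite exprMn ler_wpM2r ?exprn_ge0 //.
apply: le_trans (_ : C.+1%:R <= _); first by rewrite ler_nat.
by rewrite -natrX ler_nat -{1}(expn1 C.+1) leq_pexp2l.
Qed.
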